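(* Let $\theta>0$. The point process $\mathbf{P}_\theta$ on $\mathbb{Z}_{>0}$ defined by the poissonized Plancherel measure on strict partitions (see context) is determinantal with the correlation kernel $$\mathsf{K}_\theta(x,y)=\frac{\sqrt{xy}}{x^2-y^2}\Big(2\sqrt\theta\,J_{x-1}J_y-2\sqrt\theta\,J_{y-1}J_x-(x-y)J_xJ_y\Big),\qquad x,y\in\mathbb{Z}_{>0},$$ where $J_k=J_k(2\sqrt\theta)$ is the Bessel function of the first kind. For $x=y$ the formula is understood according to L'Hospital's rule.
   Context: $\mathbb{Z}_{>0}=\{1,2,\dots\}$. A strict partition is a finite (possibly empty) strictly decreasing sequence $\lambda=(\lambda_1>\dots>\lambda_{\ell(\lambda)})$ of positive integers; $|\lambda|=\lambda_1+\dots+\lambda_{\ell(\lambda)}$ (and $|\emptyset|=0$). The Plancherel measure on strict partitions of weight $n$ is the probability measure $$\mathrm{Pl}_n(\lambda)=\frac{2^{n-\ell(\lambda)}\,n!}{(\lambda_1!\cdots\lambda_{\ell(\lambda)}!)^2}\prod_{1\le i<j\le\ell(\lambda)}\Big(\frac{\lambda_i-\lambda_j}{\lambda_i+\lambda_j}\Big)^2,\qquad|\lambda|=n.$$ The poissonized Plancherel measure is the probability measure $\mathrm{Pl}_\theta=\sum_{n=0}^\infty\frac{(\theta/2)^ne^{-\theta/2}}{n!}\mathrm{Pl}_n$ on the set of all strict partitions. Identifying $\lambda$ with the finite set $\{\lambda_1,\dots,\lambda_{\ell(\lambda)}\}\subset\mathbb{Z}_{>0}$, the measure $\mathrm{Pl}_\theta$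 becomes a random point process $\mathbf{P}_\theta$ on $\mathbb{Z}_{>0}$. A point process on $\mathbb{Z}_{>0}$ is determinantal with correlation kernel $\mathsf{K}$ if for every finite set of distinct points $x_1,\dots,x_n$ the probability that the random configuration contains $\{x_1,\dots,x_n\}$ equals $\det[\mathsf{K}(x_i,x_j)]_{i,j=1}^n$. L'Hospital convention: $J_x(2\sqrt\theta)$ is regarded as a function of a real order $x$, and for $x=y$ the right-hand side means its limit as the real variable $y\to x$. *)

(* Defs.v *)
From HB Require Import structures.
From mathcomp Require Import all_boot all_order all_algebra.
From mathcomp Require Import all_classical all_reals all_analysis.

Set Implicit Arguments.
Unset Strict Implicit.
Unset Printing Implicit Defensive.

Import Order.TTheory GRing.Theory Num.Theory.
Import numFieldNormedType.Exports.

Local Open Scope classical_set_scope.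
Local Open Scope ring_scope.

Record strict_partition := StrictPartition {
  parts :> seq nat;
  _ : sorted gtn parts && (0%N \notin parts) }.

HB.instance Definition _ := [isSub for parts].
HB.instance Definition _ := [Countable of strict_partition by <:].

Definition empty_partition : strict_partition := @StrictPartition [::] isT.

HB.instance Definition _ := isPointed.Build strict_partition empty_partition.

HB.instance Definition _ := @isMeasurable.Build default_measure_display
  strict_partition discrete_measurable discrete_measurable0
  discrete_measurableC discrete_measurableU.

Definition part (la : strict_partition) (i : nat) : nat := nth 0%N la i.

Definition weight (la : strict_partition) : nat := sumn la.

(* The random point configuration: la seen as a subset of {1, 2, ...}. *)
Definition config (la : strict_partition) : set nat := [set x | x \in parts la].

Section Plancherel.
Context {R : realType}.

Definition plancherel_pmf (n : nat) (la : strict_partition) : R :=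
  if weight la == n then
    2 ^+ (n - size la) * n`!%:R / (\prod_(i < size la) (part la i)`!%:R) ^+ 2 *
    \prod_(i < size la) \prod_(j < size la | (i < j)%N)
      (((part la i)%:R - (part la j)%:R) / ((part la i)%:R + (part la j)%:R)) ^+ 2
  else 0.

Lemma plancherel_pmf_ge0 n la : 0 <= plancherel_pmf n la.
Proof.
rewrite /plancherel_pmf; case: ifP => // _.
apply: mulr_ge0; last by do 2 (apply: prodr_ge0 => ? _); exact: sqr_ge0.
by rewrite divr_ge0 ?sqr_ge0// mulr_ge0// exprn_ge0.
Qed.

Definition plancherel (n : nat) (U : set strict_partition) : \bar R :=
  \esum_(la in U) (plancherel_pmf n la)%:E.

Section measure.
Variable n : nat.
Local Open Scope ereal_scope.

Let plancherel0 : plancherel n set0 = 0.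
Proof. by rewrite /plancherel esum_set0. Qed.

Let plancherel_ge0 U : 0 <= plancherel n U.
Proof. by apply: esum_ge0 => la _; rewrite lee_fin plancherel_pmf_ge0. Qed.

Let plancherel_sigma_additive : semi_sigma_additive (plancherel n).
Proof.
move=> F mF tF mUF; apply: cvg_toP.
  apply: ereal_nondecreasing_is_cvgn => a b ab.
  by apply: lee_sum_nneg_natr => // k _ _; exact: plancherel_ge0.
rewrite /plancherel esum_bigcupT//; last first.
  by move=> la; rewrite lee_fin plancherel_pmf_ge0.
by rewrite nneseries_esumT// => k; exact: plancherel_ge0.
Qed.

HB.instance Definition _ := isMeasure.Build _ _ _ (plancherel n)
  plancherel0 plancherel_ge0 plancherel_sigma_additive.
End measure.

(* poisson_pmf (theta / 2) n = (theta / 2) ^+ n / n! * exp (- theta / 2)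
   for theta > 0. *)
Definition poissonized_plancherel (theta : R) :
    {measure set strict_partition -> \bar R} :=
  mseries (fun n => mscale (NngNum (poisson_pmf_ge0 (theta / 2) n))
                           (plancherel n)) 0.

(* X is a random subset of {1, 2, ...} on the measure space (T, P). The case
   n = 0 of the second clause says that P has total mass 1. *)
Definition determinantal d (T : measurableType d)
    (P : {measure set T -> \bar R}) (X : T -> set nat) (K : nat -> nat -> R) :=
  (forall x : nat, (0 < x)%N -> measurable [set w | X w x]) /\
  (forall (n : nat) (x : 'I_n -> nat),
     (forall i, (0 < x i)%N) -> injective x ->
     P [set w | forall i, X w (x i)] =
     (\det (\matrix_(i < n, j < n) K (x i) (x j)))%:E).

(* Euler's integral, meaningful for s > 0. *)
Definition Gamma (s : R) : R :=
  \int[lebesgue_measure]_(t in `]0, +oo[) (t `^ (s - 1) * expR (- t)).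

(* The entire function 1 / Gamma: for s <= 0 it is obtained from
   Gamma (s + m) = s (s + 1) ... (s + m - 1) Gamma s with s + m > 0. *)
Definition rGamma (s : R) : R :=
  let m := if 0 < s then 0%N else (Num.truncn (- s)).+1 in
  (\prod_(i < m) (s + i%:R)) / Gamma (s + m%:R).

(* J_nu(z), for real order nu and real z > 0. *)
Definition besselJ (nu z : R) : R :=
  limn (series (fun k : nat =>
    (-1) ^+ k / k`!%:R * rGamma (nu + k%:R + 1) *
    (z / 2) `^ (nu + (2 * k)%:R))).

Definition bessel_kernel_formula (theta x y : R) : R :=
  let J nu := besselJ nu (2 * Num.sqrt theta) in
  Num.sqrt (x * y) / (x ^+ 2 - y ^+ 2) *
  (2 * Num.sqrt theta * J (x - 1) * J y -
   2 * Num.sqrt theta * J (y - 1) * J x -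
   (x - y) * J x * J y).

Definition bessel_kernel (theta : R) (x y : nat) : R :=
  if x == y then lim (bessel_kernel_formula theta x%:R z @[z --> (x%:R : R)^'])
  else bessel_kernel_formula theta x%:R y%:R.

End Plancherel.

(* Main.v *)
Require Import Defs.
From mathcomp Require Import finmap.
From mathcomp Require Import all_boot all_order all_algebra.
From mathcomp Require Import all_classical all_reals all_analysis.
From mathcomp Require Import measurable_realfun.
From mathcomp Require Import ring zify.

(** Write t for the square root of theta.  By Cauchy's determinant, the mass of a
strict partition la under the poissonized Plancherel measure is
e^(-theta/2) times the principal minor indexed by la of

   L(x, y) = t^(x+y) sqrt(x y) / (x! y! (x+y)),

so the process is an L-ensemble ([pmass_det]).  Let L_N be the restriction of L
to parts at most N.  Summing the minors over the sets that contain a given set A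
yields det(1 + L_N) times the minor indexed by A of K_N = 1 - (1 + L_N)^-1
([correlation_Lmx]).  The theorem therefore amounts to two limits as N grows:
det(1 + L_N) tends to e^(theta/2), and K_N tends entrywise to the Bessel kernel.

Both limits are obtained by differentiating in t, because the derivative of L_N
has rank one: it is t u u^T with u(x) = t^(x-1) sqrt x / x!.  Writing
w = (1 + L_N)^-1 u, this gives (log det(1 + L_N))' = t u^T w and K_N' = t w w^T
([is_derive_Zdet], [is_derive_Kmx]).  For the infinite matrix L the solution w
is sqrt x J_x(2t) / t.  If the power series of J_x is cut at the terms of index
k < N - x + 1, the resulting vector v satisfies u^T v = 1 exactly, and
(1 + L_N) v = u - e where e collects a few terms of size C^N / N!
([mul_Lmx_vvec], [uvec_vvec]); both facts are finite sums of binomial type.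
The error in w is (1 + L_N)^-1 e, and it is small because the entries of
(1 + L_N)^-1 are at most 2 in absolute value: the diagonal entries of K_N are
probabilities, and its two by two minors are nonnegative ([Gmx_le2]).  The mean
value theorem then gives log det(1 + L_N) --> t^2 / 2 and

   K_N(x, y) --> sqrt(x y) int_0^t J_x(2s) J_y(2s) ds / s,

the integral being taken term by term in the product of the two power series.

It remains to sum this double series.  With a_k and b_l the terms of the two
series, the identity of Lommel type

   x - y + 2k - 2l = (x^2 - y^2 + 4k(x+k) - 4l(y+l)) / (x + y + 2k + 2l)

turns the numerator of the kernel formula into x^2 - y^2 times the double series
plus a part that telescopes, since k(x+k) a_k = - t^2 a_(k-1)
([dsum_telescope]).  All of this holds for real y > 0, with tail bounds that are
uniform in y, so the double series is continuous at y = x; together with the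
continuity of Gamma at the integers this gives the L'Hospital limit on the
diagonal. *)

Set Implicit Arguments.
Unset Strict Implicit.
Unset Printing Implicit Defensive.
Import Order.TTheory GRing.Theory Num.Theory.
Import numFieldNormedType.Exports.
Local Open Scope ring_scope.

(** * Determinantal identities *)

Section minors.
Variable F : comNzRingType.

(** Both sides are the determinant of the block matrix (1, -X; Y, 1), eliminated
from either block. *)
Lemma det_addM_comm m n (X : 'M[F]_(m, n)) (Y : 'M[F]_(n, m)) :
  \det (1%:M + X *m Y) = \det (1%:M + Y *m X).
Proof.
have h1 : block_mx 1%:M (- X) Y 1%:M
  = block_mx 1%:M 0 Y 1%:M *m block_mx 1%:M (- X) 0 (1%:M + Y *m X).
  rewrite mulmx_block !mul1mx !mul0mx !mulmx1 !addr0 mulmxN.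
  by rewrite addrCA addNr addr0.
have h2 : block_mx 1%:M (- X) Y 1%:M
  = block_mx (1%:M + X *m Y) (- X) 0 1%:M *m block_mx 1%:M 0 Y 1%:M.
  rewrite mulmx_block !mul1mx !mul0mx !mulmx1 !mulmx0 !add0r.
  by rewrite mulNmx addrK.
move: (congr1 determinant h1); rewrite h2 !det_mulmx.
by rewrite !det_lblock !det_ublock !det1 !mulr1 !mul1r.
Qed.

(** Filling the rows outside [S] with those of the identity makes the minor
indexed by [S] the determinant of a matrix of fixed size, so that minors can be
summed over [S]. *)
Definition pad_minor N (S : {set 'I_N}) (B : 'M[F]_N) : 'M[F]_N :=
  \matrix_(i, j) if i \in S then B i j else (i == j)%:R.

(** With [E] the selection matrix of [f], the padded matrix is
[1 + E^T E (B - 1)]; exchanging the two factors leaves [E B E^T]. *)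
Lemma det_pad N n (f : 'I_n -> 'I_N) (B : 'M[F]_N) : injective f ->
  \det (pad_minor [set f i | i : 'I_n] B) = \det (mxsub f f B).
Proof.
move=> f_inj; pose E : 'M[F]_(n, N) := \matrix_(i, j) (f i == j)%:R.
have EE (C : 'M[F]_N) : E *m C *m E^T = mxsub f f C.
  apply/matrixP => i j; rewrite !mxE (bigD1 (f j))//= [X in _ + X]big1 ?addr0.
    rewrite !mxE (bigD1 (f i))//= big1 ?addr0; first by rewrite !mxE !eqxx mul1r mulr1.
    by move=> k /negbTE kf; rewrite !mxE eq_sym kf mul0r.
  by move=> k /negbTE kf; rewrite !mxE [f j == k]eq_sym kf mulr0.
have -> : pad_minor [set f i | i : 'I_n] B = 1%:M + E^T *m (E *m (B - 1%:M)).
  apply/matrixP => i j; rewrite !mxE.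
  have [/imsetP[k _ ->]|iS] := boolP (i \in _).
    rewrite (bigD1 k)//= big1 ?addr0 => [|l lk]; last first.
      rewrite !mxE; case: eqP => [/f_inj lk'|]; last by rewrite mul0r.
      by rewrite lk' eqxx in lk.
    rewrite !mxE eqxx mul1r (bigD1 (f k))//= big1 ?addr0 => [|l lk]; last first.
      by rewrite !mxE eq_sym (negbTE lk) mul0r.
    by rewrite !mxE eqxx mul1r addrC subrK.
  rewrite big1 ?addr0// => k _; rewrite !mxE; case: eqP => [fki|]; last by rewrite mul0r.
  by case/imsetP: iS; exists k.
rewrite det_addM_comm EE; congr (\det _).
apply/matrixP => i j; rewrite !mxE.
by rewrite addrC (inj_eq f_inj) subrK.
Qed.

(** Multilinearity in the rows, each of which is a sum of two rows. *)
Lemma det_add_rows N (B C : 'M[F]_N) :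
  \det (B + C) =
  \sum_(S : {set 'I_N}) \det (\matrix_(i, j) if i \in S then B i j else C i j).
Proof.
rewrite /determinant exchange_big /=; apply: eq_bigr => s _.
rewrite -big_distrr /=; congr (_ * _).
under eq_bigr do rewrite mxE.
rewrite bigA_distr; apply: eq_bigr => S _.
by apply: eq_bigr => i _; rewrite mxE.
Qed.

Lemma sum_det_pad N (A : {set 'I_N}) (B : 'M[F]_N) :
  \sum_(S : {set 'I_N} | A \subset S) \det (pad_minor S B) =
  \det (B + \matrix_(i, j) (if i \in A then 0 else (i == j)%:R)).
Proof.
rewrite det_add_rows big_mkcond; apply: eq_bigr => S _ /=.
case: ifPn => [AS|/fintype.subsetPn[i iA iS]].
  congr (\det _); apply/matrixP => i j; rewrite !mxE; case: ifPn => // iS.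
  by rewrite ifN//; apply: contraNN iS; apply: (fintype.subsetP AS).
symmetry; rewrite (expand_det_row _ i) big1// => j _.
by rewrite !mxE (negbTE iS) iA mul0r.
Qed.

(** The sum of the minors over the sets containing [A] is the determinant of
[B + 1_(A^c)].  Since [B = (1 - G) (1 + B)], that matrix is
the padded matrix of [1 - G] times [1 + B]: this is why an L-ensemble has
determinantal correlations. *)
Lemma sum_det_pad_resolvent N (A : {set 'I_N}) (B G : 'M[F]_N) :
  (1%:M + B) *m G = 1%:M ->
  \sum_(S : {set 'I_N} | A \subset S) \det (pad_minor S B) =
  \det (1%:M + B) * \det (pad_minor A (1%:M - G)).
Proof.
move=> BG; rewrite sum_det_pad mulrC -det_mulmx; congr (\det _).
have GB := mulmx1C BG.
(* Inside [A] the product has the rows of [B], by this identity. *)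
have eB : B = (1%:M - G) *m (1%:M + B) by rewrite mulmxBl GB mul1mx addrAC subrr add0r.
apply/row_matrixP => i; rewrite row_mul; apply/rowP => j; rewrite !mxE.
case: (boolP (i \in A)) => iA.
  rewrite addr0 {1}eB !mxE; apply: eq_bigr => k _.
  by rewrite !mxE iA.
rewrite (bigD1 i)//= big1 ?addr0; first by rewrite !mxE (negbTE iA) eqxx mul1r addrC.
by move=> k /negbTE ki; rewrite !mxE (negbTE iA) eq_sym ki mul0r.
Qed.
End minors.

Lemma det_schur (F : fieldType) n (M : 'M[F]_(1 + n)) : M 0 0 != 0 ->
  \det M = M 0 0 * \det (\matrix_(i < n, j < n)
     (M (lift 0 i) (lift 0 j) - M (lift 0 i) 0 * M 0 (lift 0 j) / M 0 0)).
Proof.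
move=> M00; set a := M 0 0.
rewrite -[M in LHS]submxK.
have ea : ulsubmx M = a%:M.
  by apply/matrixP => i j; rewrite !ord1 !mxE eqxx mulr1n; congr (M _ _); apply: val_inj.
have -> : block_mx (ulsubmx M) (ursubmx M) (dlsubmx M) (drsubmx M) =
  block_mx 1%:M 0 (a^-1 *: dlsubmx M) 1%:M *m
  block_mx (ulsubmx M) (ursubmx M) 0 (drsubmx M - a^-1 *: (dlsubmx M *m ursubmx M)).
  rewrite mulmx_block !mul1mx !mul0mx !addr0 ea mul_mx_scalar scalerA.
  by rewrite mulfV// scale1r -scalemxAl addrC subrK.
rewrite det_mulmx det_lblock det_ublock !det1 !mul1r ea det_scalar1; congr (_ * \det _).
apply/matrixP => i j; rewrite !mxE big_ord1 !mxE.
have e0 : lshift n (0 : 'I_1) = 0 by apply: val_inj.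
by rewrite !rshift1 e0 mulrC.
Qed.

(** Cauchy's determinant with equal sets of nodes.  Eliminating the first row
leaves a matrix of the same form, in which [c i] is multiplied by
[(x 0 - x i) / (x 0 + x i)]. *)
Lemma det_cauchy_sym (F : fieldType) n (c x : 'I_n -> F) :
  (forall i j, x i + x j != 0) ->
  \det (\matrix_(i < n, j < n) (c i * c j / (x i + x j))) =
  (\prod_(i < n) (c i ^+ 2 / (x i + x i))) *
  \prod_(i < n) \prod_(j < n | (i < j)%N) ((x i - x j) / (x i + x j)) ^+ 2.
Proof.
elim: n c x => [|n IH] c x xx; first by rewrite det_mx00 !big_ord0 mulr1.
have [c0|c0] := eqVneq (c 0) 0.
  rewrite big_ord_recl c0 expr0n /= !mul0r (expand_det_row _ 0) big1// => j _.
  by rewrite !mxE c0 !mul0r.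
have M00 : (\matrix_(i < n.+1, j < n.+1) (c i * c j / (x i + x j))) 0 0 != 0.
  by rewrite mxE !mulf_neq0// invr_neq0.
rewrite (@det_schur _ n) // !mxE.
pose c' i := c (lift 0 i) * (x 0 - x (lift 0 i)) / (x 0 + x (lift 0 i)).
pose x' i := x (lift 0 i).
have -> : \matrix_(i < n, j < n)
     ((\matrix_(i < n.+1, j < n.+1) (c i * c j / (x i + x j))) (lift 0 i) (lift 0 j) -
      (\matrix_(i < n.+1, j < n.+1) (c i * c j / (x i + x j))) (lift 0 i) 0 *
      (\matrix_(i < n.+1, j < n.+1) (c i * c j / (x i + x j))) 0 (lift 0 j) /
      (c 0 * c 0 / (x 0 + x 0))) =
   \matrix_(i < n, j < n) (c' i * c' j / (x' i + x' j)).
  apply/matrixP => i j; rewrite !mxE /c' /x'.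
  have := xx (lift 0 i) (lift 0 j); have := xx 0 (lift 0 i); have := xx 0 (lift 0 j).
  rewrite [x (lift 0 i) + x 0]addrC.
  move: (x (lift 0 i)) (x (lift 0 j)) (c (lift 0 i)) (c (lift 0 j)) (xx 0 0) =>
    a b ca cb h1 h2 h3 h4.
  by field; rewrite c0 h1 h2 h3 h4.
rewrite IH; last by move=> i j; exact: xx.
have -> : \prod_(i < n) (c' i ^+ 2 / (x' i + x' i)) =
  (\prod_(i < n) (c (lift 0 i) ^+ 2 / (x (lift 0 i) + x (lift 0 i)))) *
  (\prod_(j < n) ((x 0 - x (lift 0 j)) / (x 0 + x (lift 0 j))) ^+ 2).
  rewrite -big_split; apply: eq_bigr => i _ /=; rewrite /c' /x'.
  have := xx (lift 0 i) (lift 0 i); have := xx 0 (lift 0 i) => h1 h2.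
  by field; rewrite h1 h2.
rewrite [in RHS]big_ord_recl [in X in _ = _ * X]big_ord_recl -expr2 -!mulrA.
do 4! congr (_ * _).
congr (_ * _).
  by rewrite [X in _ = X]big_mkcond big_ord_recl /= mul1r.
apply: eq_bigr => i _; rewrite [X in _ = X]big_mkcond big_ord_recl /= mul1r big_mkcond.
by apply: eq_bigr => j _.
Qed.

(** * The finite L-ensembles *)

Section ensemble.
Context {R : realType}.
Implicit Types (N n : nat) (s : R).

(** Indices are shifted throughout: the index [i] stands for the part [i.+1]. *)
Definition Lcoef (i : nat) : R := Num.sqrt i.+1%:R / i.+1`!%:R.

(** The matrix of the L-ensemble at [s], for parts at most [N]. *)
Definition Lmx N s : 'M[R]_N :=
  \matrix_(i, j) (Lcoef i * Lcoef j / (i.+1 + j.+1)%:R * s ^+ (i.+1 + j.+1)).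

(** The derivative of [Lmx N s] in [s] is [s *: (u *m u^T)], for [u] this vector. *)
Definition uvec N s : 'cV[R]_N := \col_i (Lcoef i * s ^+ i).

Definition Gmx N s : 'M[R]_N := invmx (1%:M + Lmx N s).

(** The partition function of the L-ensemble. *)
Definition Zdet N s : R := \det (1%:M + Lmx N s).

Lemma Lcoef_ge0 i : 0 <= Lcoef i.
Proof. by rewrite divr_ge0// sqrtr_ge0. Qed.

Lemma Lcoef_sqr i : Lcoef i ^+ 2 = i.+1%:R / (i.+1`!%:R) ^+ 2.
Proof. by rewrite expr_div_n sqr_sqrtr. Qed.

Lemma Lmx_tr N s : (Lmx N s)^T = Lmx N s.
Proof.
apply/matrixP => i j; rewrite !mxE [(i.+1 + _)%N]addnC.
by rewrite [Lcoef j * _]mulrC.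
Qed.

(** Up to a factor depending only on the weight, this product is the Plancherel weight of the strict
partition with parts [(f i).+1]. *)
Lemma det_mxsub_Lmx N n (f : 'I_n -> 'I_N) s :
  \det (mxsub f f (Lmx N s)) =
  (\prod_(i < n) (s ^+ 2) ^+ (f i).+1) *
  (\prod_(i < n) (2 * ((f i).+1`!%:R) ^+ 2)^-1) *
  \prod_(i < n) \prod_(j < n | (i < j)%N)
    (((f i).+1%:R - (f j).+1%:R) / ((f i).+1%:R + (f j).+1%:R)) ^+ 2.
Proof.
pose c i := Lcoef (f i) * s ^+ (f i).+1.
have -> : mxsub f f (Lmx N s) =
    \matrix_(i < n, j < n) (c i * c j / ((f i).+1%:R + (f j).+1%:R)).
  by apply/matrixP => i j; rewrite !mxE -natrD exprD /c; ring.
rewrite det_cauchy_sym => [|i j]; last by rewrite -natrD pnatr_eq0.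
congr (_ * _); rewrite -big_split; apply: eq_bigr => i _ /=.
rewrite /c exprMn Lcoef_sqr -exprM mulnC exprM.
have h : (f i).+1`!%:R != 0 :> R by rewrite pnatr_eq0 -lt0n fact_gt0.
have h' : (f i).+1%:R != 0 :> R by rewrite pnatr_eq0.
move: ((f i).+1%:R : R) ((f i).+1`!%:R : R) (s ^+ (f i).+1) h h' => a b u h h'.
by field; rewrite h -mulr2n mulrn_eq0.
Qed.

Lemma imset_enum_val N (S : {set 'I_N}) :
  [set enum_val i | i : 'I_#|S|] = S.
Proof.
apply/setP => i; apply/imsetP/idP => [[k _ ->]|iS]; first exact: enum_valP.
by exists (enum_rank_in iS i) => //; rewrite enum_rankK_in.
Qed.

Lemma det_pad_Lmx_ge0 N (S : {set 'I_N}) s : 0 <= \det (pad_minor S (Lmx N s)).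
Proof.
rewrite -(imset_enum_val S) det_pad; last exact: enum_val_inj.
rewrite det_mxsub_Lmx; apply: mulr_ge0; last first.
  by apply: prodr_ge0 => i _; apply: prodr_ge0 => j _; exact: sqr_ge0.
apply: mulr_ge0; apply: prodr_ge0 => i _; first by rewrite exprn_ge0// sqr_ge0.
by rewrite invr_ge0 mulr_ge0// sqr_ge0.
Qed.

(** By the product formula a minor is homogeneous in [s], of degree twice the
weight. *)
Lemma det_pad_Lmx N (S : {set 'I_N}) s :
  \det (pad_minor S (Lmx N s)) =
  \det (pad_minor S (Lmx N 1)) * s ^+ (\sum_(i in S) i.+1 * 2).
Proof.
rewrite -{1 2}(imset_enum_val S) !det_pad; do ?exact: enum_val_inj.
rewrite !det_mxsub_Lmx.
rewrite [X in _ = X * _ * _ * _]big1 => [|i _]; last by rewrite !expr1n.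
rewrite mul1r [RHS]mulrC !mulrA; congr (_ * _ * _).
rewrite -prodrXr [RHS]big_enum_val; apply: eq_bigr => i _ /=.
by rewrite mulnC exprM.
Qed.

Lemma Zdet_sum N s : Zdet N s = \sum_(S : {set 'I_N}) \det (pad_minor S (Lmx N s)).
Proof.
rewrite /Zdet addrC -[X in _ + X](_ : \matrix_(i, j)
  (if i \in finset.set0 then 0 else (i == j)%:R) = _).
  rewrite -sum_det_pad; apply: eq_bigl => S; by rewrite finset.sub0set.
by apply/matrixP => i j; rewrite !mxE inE.
Qed.

Lemma Zdet_ge1 N s : 1 <= Zdet N s.
Proof.
rewrite Zdet_sum (bigD1 finset.set0)//=.
have -> : pad_minor finset.set0 (Lmx N s) = 1%:M.
  by apply/matrixP => i j; rewrite !mxE inE.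
by rewrite det1 lerDl sumr_ge0// => S _; exact: det_pad_Lmx_ge0.
Qed.

Lemma Zdet_gt0 N s : 0 < Zdet N s.
Proof. exact: lt_le_trans (Zdet_ge1 N s). Qed.

Lemma mul_Gmx N s : (1%:M + Lmx N s) *m Gmx N s = 1%:M.
Proof. by rewrite mulmxV// unitmxE unitfE gt_eqF// Zdet_gt0. Qed.

Lemma Gmx_mul N s : Gmx N s *m (1%:M + Lmx N s) = 1%:M.
Proof. exact/mulmx1C/mul_Gmx. Qed.

Lemma Gmx_tr N s : (Gmx N s)^T = Gmx N s.
Proof. by rewrite /Gmx trmx_inv linearD /= trmx1 Lmx_tr. Qed.

(** The correlation kernel of the L-ensemble, [L (1 + L)^-1]. *)
Definition Kmx N s : 'M[R]_N := 1%:M - Gmx N s.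

Lemma Kmx_sym N s i j : Kmx N s i j = Kmx N s j i.
Proof.
have : (Kmx N s)^T = Kmx N s by rewrite /Kmx linearB /= trmx1 Gmx_tr.
by move=> {1}<-; rewrite mxE.
Qed.

Lemma correlation_Lmx N n (f : 'I_n -> 'I_N) s : injective f ->
  \sum_(S : {set 'I_N} | [set f i | i : 'I_n] \subset S) \det (pad_minor S (Lmx N s)) =
  Zdet N s * \det (\matrix_(i, j) Kmx N s (f i) (f j)).
Proof.
move=> fi; rewrite (sum_det_pad_resolvent _ (mul_Gmx N s)) det_pad //.
Qed.

(** The diagonal entries are the probabilities that a given part occurs. *)
Lemma Kmx_diag N s i :
  Zdet N s * Kmx N s i i = \sum_(S : {set 'I_N} | i \in S) \det (pad_minor S (Lmx N s)).
Proof.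
have fi : injective (fun _ : 'I_1 => i) by move=> a b _; rewrite !ord1.
have := correlation_Lmx s fi; rewrite det_mx11 mxE => <-.
apply: eq_bigl => S; apply/fintype.subsetP/idP => [|iS j /imsetP[_ _ ->]//].
by apply; apply/imsetP; exists 0.
Qed.

Lemma Kmx_diag_ge0 N s i : 0 <= Kmx N s i i.
Proof.
rewrite -(pmulr_rge0 _ (Zdet_gt0 N s)) Kmx_diag sumr_ge0// => S _.
exact: det_pad_Lmx_ge0.
Qed.

Lemma Kmx_diag_le1 N s i : Kmx N s i i <= 1.
Proof.
rewrite -(ler_pM2l (Zdet_gt0 N s)) mulr1 Kmx_diag Zdet_sum.
rewrite [leRHS](bigID (fun S : {set 'I_N} => i \in S)) /= lerDl sumr_ge0// => S _.
exact: det_pad_Lmx_ge0.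
Qed.

Lemma det_mx22 (A : 'M[R]_2) : \det A = A 0 0 * A 1 1 - A 0 1 * A 1 0.
Proof.
rewrite (expand_det_row _ 0) !big_ord_recl big_ord0 /cofactor !det_mx11 !mxE /=.
rewrite !expr0 !expr1 addr0 mul1r mulN1r mulrN.
by congr (A _ _ * A _ _ - A _ _ * A _ _); apply: val_inj.
Qed.

(** The two-point correlations are nonnegative, which bounds the square of an
off-diagonal entry by the product of two probabilities. *)
Lemma Kmx_le1 N s i j : `|Kmx N s i j| <= 1.
Proof.
have [->|ij] := eqVneq i j; first by rewrite ger0_norm ?Kmx_diag_ge0 ?Kmx_diag_le1.
pose f (k : 'I_2) := if k == 0 then i else j.
have fi : injective f.
  move=> a b; rewrite /f; case: a => -[|[|//]] ?; case: b => -[|[|//]] ? /=;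
    move=> h; apply/val_inj => //=; by move: h ij => -> /eqP.
have : 0 <= \det (\matrix_(k, l) Kmx N s (f k) (f l)).
  rewrite -(pmulr_rge0 _ (Zdet_gt0 N s)) -correlation_Lmx// sumr_ge0// => S _.
  exact: det_pad_Lmx_ge0.
rewrite det_mx22 ![(\matrix_(_, _) _) _ _]mxE /f /= [Kmx N s j i]Kmx_sym subr_ge0 -expr2
  => h.
rewrite -(ler_pXn2r (_ : 0 < 2)%N) ?nnegrE// expr1n real_normK ?num_real//.
apply: le_trans h _; rewrite -[leRHS]mulr1.
by rewrite ler_pM// ?Kmx_diag_ge0 ?Kmx_diag_le1.
Qed.

(** A bound independent of [N] and [s]; it is what makes approximate solutions of
linear systems with matrix [1 + L] accurate. *)
Lemma Gmx_le2 N s i j : `|Gmx N s i j| <= 2.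
Proof.
have -> : Gmx N s = 1%:M - Kmx N s by rewrite /Kmx opprB addrC subrK.
rewrite [(_ - _ : matrix _ _ _) i j]mxE [(- Kmx N s) i j]mxE;
  apply: (le_trans (ler_normB _ _)).
rewrite -[2]/(1 + 1) lerD ?Kmx_le1// mxE.
by case: (i == j); rewrite ?normr1 ?normr0.
Qed.

(** Twice the expected weight.  With [D] the diagonal matrix of the parts,
[D L + L D = s^2 u u^T], because the factor [1 / (x + y)] of [L] is cancelled;
taking the trace against [G] gives the formula. *)
Lemma sum_diag_Kmx N s :
  \sum_(i < N) i.+1%:R * Kmx N s i i *+ 2 =
    s ^+ 2 * ((uvec N s)^T *m Gmx N s *m uvec N s) 0 0.
Proof.
pose D : 'M[R]_N := diag_mx (\row_i i.+1%:R).
have DL : D *m Lmx N s + Lmx N s *m D = s ^+ 2 *: (uvec N s *m (uvec N s)^T).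
  apply/matrixP => i j; rewrite mul_diag_mx mul_mx_diag !mxE big_ord1 !mxE.
  have hs : s ^+ (i.+1 + j.+1) = s ^+ 2 * (s ^+ i * s ^+ j).
    by rewrite addSn addnS !exprS exprD; ring.
  have : i.+1%:R + j.+1%:R != 0 :> R by rewrite -natrD pnatr_eq0.
  rewrite hs natrD; move: (i.+1%:R : R) (j.+1%:R : R) (s ^+ i) (s ^+ j) (Lcoef i)
    (Lcoef j).
  by move=> a b si sj ci cj h; field.
have KG : Kmx N s = Gmx N s *m Lmx N s.
  by rewrite /Kmx -(Gmx_mul N s) mulmxDr mulmx1 addrAC subrr add0r.
have KL : Kmx N s = Lmx N s *m Gmx N s.
  by rewrite /Kmx -(mul_Gmx N s) mulmxDl mul1mx addrAC subrr add0r.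
have -> : \sum_(i < N) i.+1%:R * Kmx N s i i *+ 2 =
  \tr (D *m Kmx N s) + \tr (D *m Kmx N s).
  rewrite -mulr2n sumrMnl; congr (_ *+ _); apply: eq_bigr => i _.
  by rewrite mul_diag_mx !mxE.
rewrite {1}KG KL (mulmxA D (Lmx N s)) (mulmxA D (Gmx N s)) [X in X + _]mxtrace_mulC.
rewrite mulmxA addrC -linearD /= -mulmxDl DL -scalemxAl linearZ /= -mulmxA mxtrace_mulC.
by rewrite /mxtrace big_ord1.
Qed.

End ensemble.

(** * Dependence on the square root of the parameter *)

Section derivatives.
Context {R : realType}.
Implicit Types (N n : nat) (s : R).

(** By homogeneity of the minors the partition function is a polynomial in [s]. *)
Definition Zpoly N : {poly R} := \sum_(S : {set 'I_N})
  \det (pad_minor S (Lmx N 1)) *: 'X^(\sum_(i in S) i.+1 * 2).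

Lemma Zdet_horner N : Zdet N = horner (Zpoly N).
Proof.
apply/funext => r; rewrite Zdet_sum /Zpoly horner_sum; apply: eq_bigr => S _.
by rewrite hornerZ hornerXn det_pad_Lmx.
Qed.

(** Differentiating a monomial multiplies it by its degree, so [s Z'] is [Z] times
twice the expected weight. *)
Lemma is_derive_Zdet N s : s != 0 ->
  is_derive s 1 (Zdet N)
    (s * (Zdet N s * ((uvec N s)^T *m Gmx N s *m uvec N s) 0 0)).
Proof.
move=> s0.
rewrite {1}Zdet_horner; apply: is_derive_eq.
apply: (mulfI s0).
rewrite /Zpoly raddf_sum horner_sum mulr_sumr.
transitivity (\sum_(S : {set 'I_N}) \sum_(i in S) \det (pad_minor S (Lmx N s)) *
  i.+1%:R *+ 2).
  apply: eq_bigr => S _; rewrite /= derivZ derivXn hornerZ hornerMn hornerXn.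
  rewrite sumrMnl -mulr_sumr [in RHS]det_pad_Lmx; set m := (\sum_(i in S) _)%N.
  have em : (\sum_(i in S) i.+1%:R) *+ 2 = m%:R :> R.
    by rewrite -mulr_natr -natr_sum -natrM big_distrl.
  rewrite -mulrnAr em -(mulr_natr (_ ^+ _)); case: m em => [|m] _;
    first by rewrite !mulr0.
  by rewrite exprS; ring.
rewrite (mulrA s s) -expr2 mulrCA -sum_diag_Kmx mulr_sumr.
under eq_bigr do rewrite big_mkcond /=.
rewrite exchange_big /=; apply: eq_bigr => i _.
rewrite mulrnAr mulrCA Kmx_diag mulr_sumr -sumrMnl [RHS]big_mkcond /=.
by apply: eq_bigr => S _; case: ifP => // _; rewrite mulrC.
Qed.

(** From [(1 + L) G = 1] one gets [G' = - G L' G], and [L' = s u u^T].  The entries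
of [G] are rational functions of [s], which gives their differentiability. *)
Lemma is_derive_Kmx N s i j :
  is_derive s 1 (fun r => Kmx N r i j)
   (s * ((Gmx N s *m uvec N s) i 0 * (Gmx N s *m uvec N s) j 0)).
Proof.
(* [1 + L] as a matrix of polynomials in [s]. *)
pose P : 'M[{poly R}]_N := 1%:M +
  \matrix_(i, j) ((Lcoef i * Lcoef j / (i.+1 + j.+1)%:R) *: 'X^(i.+1 + j.+1)).
have PE r : 1%:M + Lmx N r = map_mx (horner_eval r) P.
  apply/matrixP => a b; rewrite !mxE /horner_eval hornerD hornerMn hornerC.
  by rewrite hornerZ hornerXn.
pose A a b := horner (P a b).
have AE r a b : (1%:M + Lmx N r) a b = A a b r by rewrite PE mxE.
have GE a b r : Gmx N r a b = (horner (\det P) r)^-1 * horner (\adj P a b) r.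
  rewrite /Gmx PE /invmx -PE unitmxE unitfE gt_eqF ?Zdet_gt0// !PE !mxE.
  by rewrite det_map_mx cofactor_map_mx.
have dG a b : derivable (fun r => Gmx N r a b) s 1.
  have -> : (fun r => Gmx N r a b) =
    (fun r => (horner (\det P) r)^-1) * horner (\adj P a b).
    by apply/funext => r; rewrite GE.
  apply: derivableM; last exact: derivable_horner.
  apply: derivableV; last exact: derivable_horner.
  rewrite (_ : _.[s] = Zdet N s) ?gt_eqF ?Zdet_gt0//.
  by rewrite /Zdet PE det_map_mx.
pose G' : 'M[R]_N := \matrix_(a, b) 'D_1 (fun r => Gmx N r a b) s.
have A'E a b : (P a b)^`().[s] = s * (uvec N s *m (uvec N s)^T) a b.
  rewrite /P !mxE big_ord1 !mxE derivD derivZ derivXn hornerD.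
  have -> : ((a == b)%:R : {poly R})^`() = 0.
    by case: (a == b); rewrite ?derivC.
  rewrite horner0 add0r hornerZ hornerMn hornerXn addSn addnS /= exprS exprD.
  rewrite -(mulr_natr (_ * _) (a + b).+2).
  have : (a + b).+2%:R != 0 :> R by rewrite pnatr_eq0.
  move: ((a + b).+2%:R : R) => m m0. field => //.
have eq0 : s *: (uvec N s *m (uvec N s)^T) *m Gmx N s + (1%:M + Lmx N s) *m G' = 0.
  apply/matrixP => a b; rewrite [LHS]mxE [X in X + _]mxE [X in _ + X]mxE [RHS]mxE
    -big_split /=.
  pose f : R -> R := \sum_(k < N) (A a k * (fun r => Gmx N r k b)).
  have fE : f = cst ((a == b)%:R).
    apply/funext => r; rewrite /f fct_sumE /=.
    have := congr1 (fun M : 'M[R]_N => M a b) (mul_Gmx N r).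
    by rewrite [LHS]mxE [RHS]mxE => <-; apply: eq_bigr => k _; rewrite AE.
  have d1 : is_derive s 1 f (\sum_(k < N)
      (A a k s *: 'D_1 (fun r => Gmx N r k b) s + Gmx N s k b *: (P a k)^`().[s])).
    apply: is_derive_sum => k; apply: is_deriveM; exact: derivableP.
  have d2 : is_derive s 1 f 0 by rewrite fE; exact: is_derive_cst.
  have : \sum_(k < N)
      (A a k s *: 'D_1 (fun r => Gmx N r k b) s + Gmx N s k b *: (P a k)^`().[s]) = 0.
    by rewrite -(@derive_val _ _ _ _ _ _ _ d1) -[RHS](@derive_val _ _ _ _ _ _ _ d2).
  move=> h; rewrite -[RHS]h; apply: eq_bigr => k _.
by rewrite A'E AE [G' k b]mxE [(s *: (_ : 'M[R]_N)) a k]mxE addrC [_ * Gmx _ _ _ _]mulrC.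
have G'E : G' = - (Gmx N s *m (s *: (uvec N s *m (uvec N s)^T) *m Gmx N s)).
  apply/eqP; rewrite -addr_eq0 addrC; apply/eqP.
  have := congr1 (mulmx (Gmx N s)) eq0.
  by rewrite mulmxDr mulmx0 [X in _ + X]mulmxA Gmx_mul mul1mx.
have KE : (fun r : R => Kmx N r i j) = (cst ((i == j)%:R) : R -> R) -
  (fun r : R => Gmx N r i j).
  by apply/funext => r; rewrite /Kmx !mxE.
have d : is_derive s 1 (fun r => Gmx N r i j) (G' i j).
  by rewrite mxE; exact: derivableP.
rewrite KE; apply: is_derive_eq; rewrite sub0r G'E mxE opprK.
rewrite -scalemxAl -scalemxAr mxE -mulmxA (mulmxA (Gmx N s)); congr (_ * _).
have -> : (uvec N s)^T *m Gmx N s = (Gmx N s *m uvec N s)^T.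
  by rewrite trmx_mul Gmx_tr.
rewrite mxE big_ord1; congr (_ * _).
by rewrite mxE.
Qed.

End derivatives.

(** * An explicit approximate solution of the linear system *)

Section approximate_solution.
Context {R : realType}.
Implicit Types (N n : nat) (s : R).

(** A sum over a triangle, by rows and by diagonals. *)
Lemma sum_triangle (V : nmodType) (F : nat -> nat -> V) N :
  \sum_(j < N) \sum_(k < N - j) F j k = \sum_(m < N) \sum_(j < m.+1) F j (m - j)%N.
Proof.
elim: N => [|N IH]; first by rewrite !big_ord0.
rewrite [RHS]big_ord_recr /= -IH big_ord_recr /= subSnn big_ord1.
rewrite [X in _ = _ + X]big_ord_recr /= subnn addrA; congr (_ + _).
rewrite -big_split; apply: eq_bigr => j _ /=.
by rewrite subSn ?big_ord_recr //= ltnW.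
Qed.

(** The integral of [z^p (1 - z)^m] over the unit interval, expanded by the binomial
theorem.  The induction on [m] is Pascal's rule. *)
Lemma beta_sum m p :
  \sum_(j < m.+1) (-1) ^+ j * 'C(m, j)%:R / (p.+1 + j)%:R =
  m`!%:R * p`!%:R / (p + m).+1`!%:R :> R.
Proof.
elim: m p => [|m IH] p.
  rewrite big_ord1 !addn0 bin0 fact0 factS natrM !mul1r.
  by rewrite invfM mulrA mulrAC mulrV ?mul1r// unitfE pnatr_eq0 -lt0n fact_gt0.
pose f p j : R := (-1) ^+ j * 'C(m, j)%:R / (p.+1 + j)%:R.
transitivity (\sum_(j < m.+1) f p j - \sum_(j < m.+1) f p.+1 j).
  rewrite big_ord_recl [X in _ = X - _]big_ord_recl -!addrA; congr (_ + _).
    by rewrite /f !bin0.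
  have -> : \sum_(i < m) f p (bump 0 i) = \sum_(i < m.+1) f p i.+1.
    by rewrite [RHS]big_ord_recr /= [X in _ = _ + X]/f bin_small// mulr0 mul0r addr0.
  rewrite -sumrB; apply: eq_bigr => j _; rewrite /= /bump leq0n add1n /f binS natrD.
   by rewrite addnS addSn exprS; ring.
rewrite !IH !addnS !addSn !factS !natrM.
have h : (p + m)`!%:R != 0 :> R by rewrite pnatr_eq0 -lt0n fact_gt0.
have h1 : (p + m).+1%:R != 0 :> R by rewrite pnatr_eq0.
have h2 : (p + m).+2%:R != 0 :> R by rewrite pnatr_eq0.
have e1 : (p + m).+2%:R = p%:R + m%:R + 2 :> R by rewrite -addn2 !natrD.
have e2 : p.+1%:R = p%:R + 1 :> R by rewrite -addn1 !natrD.
have e3 : m.+1%:R = m%:R + 1 :> R by rewrite -addn1 !natrD.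
rewrite e2 e3; rewrite e1 in h2 *.
move: ((p + m)`!%:R : R) ((p + m).+1%:R : R) (m`!%:R : R) (p`!%:R : R) h h1 =>
  a b c d h h1.
by field; rewrite h h1 h2.
Qed.

Lemma alt_sum_binomial m (g : nat -> R) :
  \sum_(j < m.+1) (-1) ^+ (m - j) / (j`!%:R * (m - j)`!%:R) * g j =
  (-1) ^+ m / m`!%:R * \sum_(j < m.+1) (-1) ^+ j * 'C(m, j)%:R * g j.
Proof.
rewrite mulr_sumr; apply: eq_bigr => -[j /= jm] _.
rewrite ltnS in jm; rewrite -signr_odd oddB// signr_addb !signr_odd.
rewrite -natrM -(bin_fact jm) [in RHS]natrM.
have h : (j`! * (m - j)`!)%:R != 0 :> R by rewrite pnatr_eq0 -lt0n muln_gt0 !fact_gt0.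
have h' : 'C(m, j)%:R != 0 :> R by rewrite pnatr_eq0 -lt0n bin_gt0.
move: ((j`! * (m - j)`!)%:R : R) ('C(m, j)%:R : R) ((-1) ^+ m) ((-1) ^+ j) (g j) h h' =>
  a b c d e h h'.
by field; rewrite h h'.
Qed.

(** The terms of [J_(i+1)(2s) / s]. *)
Definition bessel_term (i k : nat) s : R :=
  (-1) ^+ k * s ^+ (i + k * 2) / (k`!%:R * (i.+1 + k)`!%:R).

(** The cut at [k < N - i] keeps exactly the pairs with [i + k < N]: in [L v] the
terms can then be grouped along complete diagonals. *)
Definition vvec N s : 'cV[R]_N :=
  \col_i (Num.sqrt i.+1%:R * \sum_(k < N - i) bessel_term i k s).

Definition evec N s : 'cV[R]_N :=
  \col_i (Num.sqrt i.+1%:R * \sum_(N - i <= k < N.+1) bessel_term i k s).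

Lemma Lcoef_sqrt i : Lcoef i * Num.sqrt i.+1%:R = (i`!%:R)^-1 :> R.
Proof.
rewrite /Lcoef mulrAC -expr2 sqr_sqrtr// factS natrM invfM mulrA mulfV ?mul1r//.

Qed.

(** The terms of [L v] with [j + k = m] add up, by the beta integral, to minus the
term of index [m + 1] of the Bessel series of order [i + 1], for all [m < N].
So [v + L v] consists of the term of index 0, which is [u], minus the terms that
[L v] has in excess (all of them multiplied by the square root of [i + 1]). *)
Lemma mul_Lmx_vvec N s : (1%:M + Lmx N s) *m vvec N s = uvec N s - evec N s.
Proof.
rewrite mulmxDl mul1mx; apply/colP => i; rewrite !mxE.
have -> : \sum_j Lmx N s i j * vvec N s j 0 =
    - (Num.sqrt i.+1%:R * \sum_(m < N) bessel_term i m.+1 s).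
  transitivity (\sum_(j < N) \sum_(k < N - j) Lcoef i * s ^+ i *
    ((-1) ^+ k / (j`!%:R * k`!%:R) / (i.+2 + j)%:R *
      (s ^+ (j + k).+1 ^+ 2 / (j + k).+1`!%:R))).
    apply: eq_bigr => j _; rewrite !mxE mulrA mulr_sumr; apply: eq_bigr => k _.
    have hs : s ^+ i * s ^+ (j + k).+1 ^+ 2 = s ^+ (i.+1 + j.+1) * s ^+ (j + k * 2).
      by rewrite -exprM -!exprD; congr (_ ^+ _); lia.
    rewrite (invfM j`!%:R) -(Lcoef_sqrt j) /bessel_term (addSnnS i.+1 j) (addSn j k).
    rewrite [LHS](_ : _ = Lcoef i * (s ^+ (i.+1 + j.+1) * s ^+ (j + k * 2)) *
      ((-1) ^+ k * Lcoef j * Num.sqrt j.+1%:R / k`!%:R / (i.+1 + j.+1)%:R /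
        (j + k).+1`!%:R)).
      by rewrite -hs; ring.
    by rewrite invfM; move: (s ^+ _) (s ^+ _) => a b; ring.
  rewrite (sum_triangle (fun j k => Lcoef i * s ^+ i *
    ((-1) ^+ k / (j`!%:R * k`!%:R) / (i.+2 + j)%:R *
    (s ^+ (j + k).+1 ^+ 2 / (j + k).+1`!%:R)))).
  rewrite mulr_sumr -sumrN; apply: eq_bigr => m _.
  transitivity (Lcoef i * s ^+ i * (\sum_(j < m.+1) (-1) ^+ (m - j) /
    (j`!%:R * (m - j)`!%:R) * ((i.+2 + j)%:R)^-1) * (s ^+ m.+1 ^+ 2 / m.+1`!%:R)).
    rewrite mulr_sumr mulr_suml; apply: eq_bigr => -[j /= jm] _.
    by rewrite subnKC// !mulrA.
  rewrite (alt_sum_binomial m (fun j => (i.+2 + j)%:R^-1)) beta_sum /Lcoef /bessel_term.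
  have fN0 q : q`!%:R != 0 :> R by rewrite pnatr_eq0 -lt0n fact_gt0.
  rewrite [(-1) ^+ m.+1]exprS exprD exprM -exprM mulnC exprM -(addnS i.+1 m).
  move: (fN0 m) (fN0 i.+1) (fN0 (i.+1 + m.+1)%N) (fN0 m.+1).
  move: (m`!%:R : R) (i.+1`!%:R : R) ((i.+1 + m.+1)`!%:R : R) (m.+1`!%:R : R).
  move: (s ^+ i) (s ^+ 2 ^+ m.+1) ((-1) ^+ m) (Num.sqrt _) => a b c d e f g h e0 f0 g0 h0.
  by field; rewrite e0 f0 g0 h0.
rewrite -mulrBr.
have -> : Lcoef i * s ^+ i = Num.sqrt i.+1%:R * bessel_term i 0 s.
  by rewrite /bessel_term /Lcoef fact0 !addn0 mul1r mul1r mulrA mulrAC.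
rewrite -mulrBr; congr (_ * _); apply/eqP; rewrite subr_eq addrAC eq_sym subr_eq.
rewrite -(big_mkord xpredT (bessel_term i ^~ s)) -big_cat_nat //=;
  first by rewrite big_mkord big_ord_recl.
by rewrite leqW// leq_subr.
Qed.

(** Along the diagonal [j + k = m] the sum is a multiple of [(1 - 1)^m]. *)
Lemma uvec_vvec N s : (0 < N)%N -> ((uvec N s)^T *m vvec N s) 0 0 = 1.
Proof.
case: N => // N _; rewrite mxE.
transitivity (\sum_(j < N.+1) \sum_(k < N.+1 - j)
    ((-1) ^+ k / (j`!%:R * k`!%:R) * 1 * (s ^+ (j + k) ^+ 2 / (j + k).+1`!%:R))).
  apply: eq_bigr => j _; rewrite !mxE mulrA mulr_sumr; apply: eq_bigr => k _.
  rewrite [Lcoef j * _ * _]mulrAC Lcoef_sqrt /bessel_term.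
  have hs : s ^+ (j + k) ^+ 2 = s ^+ j * s ^+ (j + k * 2).
    by rewrite -exprM -!exprD; congr (_ ^+ _); lia.
  by rewrite hs addSn !invfM; ring.
rewrite (sum_triangle (fun j k => (-1) ^+ k /
  (j`!%:R * k`!%:R) * 1 * (s ^+ (j + k) ^+ 2 / (j + k).+1`!%:R))).
transitivity (\sum_(m < N.+1) (-1) ^+ m /
  m`!%:R * (1 - 1) ^+ m * (s ^+ m ^+ 2 / m.+1`!%:R)).
  apply: eq_bigr => m _.
  have -> : (1 - 1) ^+ m = \sum_(j < m.+1) (-1) ^+ j * 'C(m, j)%:R * 1 :> R.
    rewrite exprDn; apply: eq_bigr => j _; by rewrite expr1n mul1r mulr1 mulr_natr.
  rewrite -(alt_sum_binomial m (fun=> 1)) mulr_suml; apply: eq_bigr => -[j /= jm] _.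
  by rewrite subnKC.
rewrite big_ord_recl big1 ?addr0.
  by rewrite !expr0 expr1n fact0 !divr1 !mulr1.
by move=> m _; rewrite subrr expr0n /= mulr0 mul0r.
Qed.

End approximate_solution.

Local Open Scope classical_set_scope.
Local Open Scope ring_scope.

(** * Size of the truncation errors *)

Section estimates.
Context {R : realType}.
Implicit Types (N n : nat) (s T : R).

Lemma sum_exp_coeff_le x n : 0 <= x -> \sum_(k < n) x ^+ k / k`!%:R <= expR x :> R.
Proof.
move=> x0; have := @nondecreasing_cvgn_le R (series (exp_coeff x)).
have nd : nondecreasing_seq (series (exp_coeff x)).
  by apply/nondecreasing_seqP => k; rewrite /series /= big_nat_recr//= lerDl
    exp_coeff_ge0.
move/(_ nd (is_cvg_series_exp_coeff x) n).
by rewrite /series /= big_mkord.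
Qed.

(** A common bound for the truncation errors when [`|s| <= B]. *)
Definition trunc_err (B : R) N : R := 2 * exp_coeff (16 * B ^+ 4) N.

Lemma cvg_trunc_err B : trunc_err B @ \oo --> (0 : R).
Proof.
by rewrite -(mulr0 2); apply: cvgM; [exact: cvg_cst|exact: cvg_exp_coeff].
Qed.

Lemma nat_le_expn2 N : N%:R <= 2 ^+ N :> R.
Proof. by rewrite -natrX ler_nat ltnW// ltn_expl. Qed.

Lemma sqrt_le_nat n : Num.sqrt n%:R <= n%:R :> R.
Proof.
rewrite -[leRHS]ger0_norm// -sqrtr_sqr ler_sqrt ?sqr_ge0// -natrX ler_nat.
by case: n => // n; rewrite leq_pmulr.
Qed.

Lemma Lcoef_le1 i : Lcoef i <= 1 :> R.
Proof.
rewrite /Lcoef ler_pdivrMr ?ltr0n ?fact_gt0// mul1r.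
by apply: le_trans (sqrt_le_nat _) _; rewrite ler_nat fact_geq.
Qed.

Section bounds.
Variables (B s : R) (N : nat).
Hypotheses (B1 : 1 <= B) (sB : `|s| <= B).

Let B0 : 0 <= B. Proof. exact: le_trans ler01 B1. Qed.

Lemma norm_bessel_term i k : `|bessel_term i k s| <= B ^+ (i + k * 2) / k`!%:R.
Proof.
rewrite /bessel_term normrM normrM normrX normrN1 expr1n mul1r normrX normfV.
rewrite [X in _ * X^-1]ger0_norm//.
apply: ler_pM => //; rewrite ?invr_ge0//.
  by apply: lerXn2r => //; rewrite nnegrE.
rewrite lef_pV2 ?posrE -?natrM ?ltr0n ?muln_gt0 ?fact_gt0// ler_nat.
by rewrite leq_pmulr// fact_gt0.
Qed.

Lemma norm_vvec (i : 'I_N) :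
  `|vvec N s i 0| <= Num.sqrt i.+1%:R * (B ^+ i * expR (B ^+ 2)).
Proof.
rewrite mxE normrM ger0_norm ?sqrtr_ge0// ler_wpM2l ?sqrtr_ge0//.
apply: (le_trans (ler_norm_sum _ _ _)).
apply: le_trans; first by apply: ler_sum => k _; exact: norm_bessel_term.
under eq_bigr do rewrite exprD -mulrA mulnC exprM.
rewrite -mulr_sumr ler_wpM2l ?exprn_ge0//.
by apply: sum_exp_coeff_le; rewrite exprn_ge0.
Qed.

(** Every term of the error has a factorial of an argument larger than [N] in the
denominator, and there are at most [N] terms. *)
Lemma norm_evec (i : 'I_N) :
  `|evec N s i 0| <= N%:R * (N%:R * (B ^+ (3 * N) / N`!%:R)).
Proof.
rewrite mxE normrM ger0_norm ?sqrtr_ge0//.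
apply: ler_pM => //.
  by apply: le_trans (sqrt_le_nat _) _; rewrite ler_nat.
apply: (le_trans (ler_norm_sum _ _ _)).
apply: (@le_trans _ _ (\sum_(N - i <= k < N.+1) (B ^+ (3 * N) / N`!%:R))).
  rewrite big_nat [leRHS]big_nat; apply: ler_sum => k /andP[k1 k2].
  rewrite /bessel_term normrM normrM normrX normrN1 expr1n mul1r normrX normfV.
  rewrite [X in _ * X^-1]ger0_norm//.
  apply: ler_pM => //; rewrite ?invr_ge0//.
    apply: (@le_trans _ _ (B ^+ (i + k * 2))).
      by apply: lerXn2r => //; rewrite nnegrE.
    by apply: ler_weXn2l => //; have := ltn_ord i; lia.
  rewrite lef_pV2 ?posrE -?natrM ?ltr0n ?muln_gt0 ?fact_gt0// ler_nat.
  apply: leq_trans (leq_pmull _ (fact_gt0 _)).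
  by apply: leq_fact; lia.
rewrite sumr_const_nat -(mulr_natl (_ / _)); apply: ler_wpM2r.
  by rewrite divr_ge0// exprn_ge0.
by rewrite ler_nat; have := ltn_ord i; lia.
Qed.

Lemma sum_norm_evec :
  \sum_(i < N) `|evec N s i 0| <= (8 * B ^+ 3) ^+ N / N`!%:R.
Proof.
apply: le_trans; first by apply: ler_sum => i _; exact: norm_evec.
rewrite sumr_const card_ord -[leLHS]mulr_natl.
have -> : (8 * B ^+ 3) ^+ N = 2 ^+ N * (2 ^+ N * (2 ^+ N * B ^+ (3 * N))).
  by rewrite exprM -!exprMn; congr (_ ^+ _); ring.
rewrite -!mulrA; do 3! (apply: ler_pM; rewrite ?mulr_ge0 ?divr_ge0 ?exprn_ge0
  ?nat_le_expn2//).
Qed.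

Lemma sum_norm_uvec : \sum_(i < N) `|uvec N s i 0| <= (2 * B) ^+ N.
Proof.
apply: (@le_trans _ _ (\sum_(i < N) B ^+ N)).
  apply: ler_sum => i _; rewrite mxE normrM -[leRHS]mul1r; apply: ler_pM => //.
    by rewrite ger0_norm ?Lcoef_ge0// Lcoef_le1.
  rewrite normrX; apply: (@le_trans _ _ (B ^+ i)).
    by apply: lerXn2r => //; rewrite nnegrE.
  by apply: ler_weXn2l => //; exact: ltnW.
rewrite sumr_const card_ord -[leLHS]mulr_natl exprMn ler_wpM2r ?exprn_ge0//.
exact: nat_le_expn2.
Qed.

Lemma norm_Gmx_evec (i : 'I_N) : `|(Gmx N s *m evec N s) i 0| <=
  2 * ((8 * B ^+ 3) ^+ N / N`!%:R).
Proof.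
rewrite mxE; apply: (le_trans (ler_norm_sum _ _ _)).
apply: (@le_trans _ _ (2 * \sum_(j < N) `|evec N s j 0|)).
  rewrite mulr_sumr; apply: ler_sum => j _; rewrite normrM ler_wpM2r//.
  exact: Gmx_le2.
by rewrite ler_wpM2l// sum_norm_evec.
Qed.

Lemma norm_Gmx_evec_err (i : 'I_N) : `|(Gmx N s *m evec N s) i 0| <= trunc_err B N.
Proof.
apply: le_trans (norm_Gmx_evec i) _; rewrite ler_wpM2l//.
rewrite /exp_coeff /= ler_wpM2r ?invr_ge0// lerXn2r ?nnegrE ?mulr_ge0 ?exprn_ge0//.
apply: ler_pM => //; rewrite ?exprn_ge0// ?ler_nat//.
exact: ler_weXn2l.
Qed.

Lemma norm_quadratic_err :
  `|((uvec N s)^T *m Gmx N s *m evec N s) 0 0| <= trunc_err B N.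
Proof.
rewrite -mulmxA mxE; apply: (le_trans (ler_norm_sum _ _ _)).
apply: (@le_trans _ _ ((2 * B) ^+ N * (2 * ((8 * B ^+ 3) ^+ N / N`!%:R)))).
  apply: le_trans (ler_wpM2r _ sum_norm_uvec).
    rewrite mulr_suml; apply: ler_sum => i _; rewrite normrM mxE ler_wpM2l//.
    exact: norm_Gmx_evec.
  by rewrite mulr_ge0// divr_ge0// exprn_ge0// mulr_ge0// exprn_ge0.
rewrite /trunc_err /exp_coeff /= mulrCA ler_wpM2l// mulrA -exprMn.
by rewrite (_ : 2 * B * (8 * B ^+ 3) = 16 * B ^+ 4)//; ring.
Qed.

(** The exact solution of [(1 + L) w = u] is the approximate one plus [G e]. *)
Lemma Gmx_uvec : Gmx N s *m uvec N s = vvec N s + Gmx N s *m evec N s.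
Proof.
have -> : uvec N s = (1%:M + Lmx N s) *m vvec N s + evec N s.
  by rewrite mul_Lmx_vvec subrK.
by rewrite mulmxDr mulmxA Gmx_mul mul1mx.
Qed.

Lemma quadratic_uvec : (0 < N)%N ->
  ((uvec N s)^T *m Gmx N s *m uvec N s) 0 0 =
  1 + ((uvec N s)^T *m Gmx N s *m evec N s) 0 0.
Proof.
move=> N0; rewrite -mulmxA Gmx_uvec mulmxDr [LHS]mxE uvec_vvec//.
by rewrite -mulmxA.
Qed.

Lemma norm_mul_Gmx_uvec (i j : 'I_N) :
  `|(Gmx N s *m uvec N s) i 0 * (Gmx N s *m uvec N s) j 0
    - vvec N s i 0 * vvec N s j 0| <=
  trunc_err B N * (Num.sqrt i.+1%:R * (B ^+ i * expR (B ^+ 2)) +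
             Num.sqrt j.+1%:R * (B ^+ j * expR (B ^+ 2)) + trunc_err B N).
Proof.
rewrite Gmx_uvec ![(_ + _ : 'cV[R]_N) _ _]mxE.
have := norm_Gmx_evec_err i; have := norm_Gmx_evec_err j.
have := norm_vvec i; have := norm_vvec j.
set gi := (_ *m _) i 0; set gj := (_ *m _) j 0.
set vi := vvec _ _ i 0; set vj := vvec _ _ j 0.
set ci := Num.sqrt i.+1%:R * _; set cj := Num.sqrt j.+1%:R * _.
move=> hj hi ej ei.
rewrite (_ : _ - _ = vi * gj + vj * gi + gi * gj); last by ring.
apply: (le_trans (ler_normD _ _)).
rewrite mulrDr lerD//; last by rewrite normrM ler_pM.
apply: (le_trans (ler_normD _ _)).
by rewrite mulrDr lerD// normrM mulrC ler_pM.
Qed.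
End bounds.
End estimates.

(** * Limits of the partition function and of the kernel entries *)

Section limits.
Context {R : realType}.
Implicit Types (N n : nat) (s T : R).

Lemma Lmx0 N : Lmx N 0 = 0 :> 'M[R]_N.
Proof. by apply/matrixP => i j; rewrite !mxE addSn exprS mul0r mulr0. Qed.

Lemma cvg_dist_bound (I : Type) (F : set_system I) (FF : Filter F) (u b : I -> R)
  (l : R) :
  (\forall x \near F, `|u x - l| <= b x) -> b @ F --> (0 : R) -> u @ F --> l.
Proof.
move=> ub b0; have h := @squeeze_cvgr _ _ FF _ (fun x => l - b x) (fun x => l + b x) u;
  apply: h.
- near=> x; rewrite -ler_distlC distrC; by near: x.
- by rewrite -[X in _ --> X]subr0; apply: cvgB => //; exact: cvg_cst.
- by rewrite -[X in _ --> X]addr0; apply: cvgD => //; exact: cvg_cst.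
Unshelve. all: by end_near. Qed.

Lemma cvg_shift_succ B (u : R^nat) (l : R) :
  u @ \oo --> l -> (fun N => u (N + B).+1) @ \oo --> l.
Proof.
by move=> ul; rewrite (cvg_shiftn B (fun N => u N.+1)) (cvg_shiftS u).
Qed.

Lemma cvg_det n (M : nat -> 'M[R]_n) (A : 'M[R]_n) :
  (forall i j, (fun N => M N i j) @ \oo --> A i j) ->
  (fun N => \det (M N)) @ \oo --> \det A.
Proof.
move=> MA; apply: cvg_big => [|s _]; first exact: add_continuous.
apply: cvgM; first exact: cvg_cst.
by apply: cvg_big => [|i _]; [exact: mul_continuous|exact: MA].
Qed.

(** The derivative is only required inside the interval because [is_derive_Zdet]
holds away from 0. *)
Lemma derivative_bound (f df : R -> R) (a C : R) : 0 < a ->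
  (forall x, 0 < x < a -> is_derive x 1 f (df x)) ->
  {within `[0, a], continuous f} ->
  (forall x, 0 < x < a -> `|df x| <= C) ->
  `|f a - f 0| <= C * a.
Proof.
move=> a0 fd fc dfC.
have fd' x : x \in `]0, a[ -> is_derive x 1 f (df x) by rewrite in_itv; exact: fd.
have [c] := MVT a0 fd' fc; rewrite in_itv /= => ca ->;
  rewrite subr0 normrM (gtr0_norm a0).
by rewrite ler_wpM2r ?(ltW a0)// dfC.
Qed.

(** The derivative of the logarithm is [s u^T G u = s (u^T v + u^T G e)], and
[u^T v = 1]. *)
Lemma ln_Zdet_bound N T : (0 < N)%N -> 0 < T ->
  `|ln (Zdet N T) - T ^+ 2 / 2| <= T * trunc_err (1 + T) N * T.
Proof.
move=> N0 T0.
pose f s := ln (Zdet N s) - s ^+ 2 / 2.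
pose df s := s * ((uvec N s)^T *m Gmx N s *m evec N s) 0 0.
have fE : f = (@ln R \o Zdet N) - (fun s => 2^-1 *: s ^+ 2).
  by apply/funext => s; rewrite /f /= mulrC.
have f0 : f 0 = 0.
  by rewrite /f /Zdet Lmx0 addr0 det1 ln1 expr0n /= mul0r subrr.
have -> : ln (Zdet N T) - T ^+ 2 / 2 = f T - f 0 by rewrite f0 subr0.
apply: (@derivative_bound _ df) => //.
- move=> x /andP[x0 _].
  have d1 := is_derive_Zdet N (lt0r_neq0 x0).
  have d2 := is_derive1_comp (is_derive1_ln (Zdet_gt0 N x)) d1.
  rewrite fE; apply: is_derive_eq.
  rewrite quadratic_uvec// /df.
  have := Zdet_gt0 N x; move: (Zdet N x) (_ 0 0) => z q z0.
  rewrite /GRing.scale /= ?expr1 ?mulr1.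
  by field; rewrite gt_eqF.
- apply: continuous_subspaceT => x; rewrite fE.
  apply: continuousB.
    apply: continuous_comp; last exact/continuous_ln/Zdet_gt0.
    by rewrite Zdet_horner; exact: continuous_horner.
  by apply: differentiable_continuous; apply/derivable1_diffP.
- move=> x /andP[x0 xT]; rewrite normrM (gtr0_norm x0).
  apply: ler_pM => //; [exact: ltW|exact: ltW|].
  apply: norm_quadratic_err; first by rewrite lerDl ltW.
  by rewrite gtr0_norm// (le_trans (ltW xT))// lerDr.
Qed.

Lemma cvg_Zdet T : 0 < T -> (fun N => Zdet N T) @ \oo --> expR (T ^+ 2 / 2).
Proof.
move=> T0.
have -> : (fun N => Zdet N T) = expR \o (fun N => ln (Zdet N T)).
  by apply/funext => N /=; rewrite lnK// posrE Zdet_gt0.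
apply: continuous_cvg; first exact: continuous_expR.
apply: (@cvg_dist_bound _ _ _ _ (fun N => T * trunc_err (1 + T) N * T)).
  by exists 1%N => // N /= N1; exact: ln_Zdet_bound.
have h : (fun N => T * trunc_err (1 + T) N * T) @ \oo --> T * 0 * T.
  by apply: cvgM; [apply: cvgM; [exact: cvg_cst|exact: cvg_trunc_err]|exact: cvg_cst].
by rewrite mulr0 mul0r in h.
Qed.

(** The antiderivative, vanishing at 0, of [s v_i v_j], with cuts [p] and [q]. *)
Definition Kpoly (i j p q : nat) : {poly R} :=
  (Num.sqrt i.+1%:R * Num.sqrt j.+1%:R) *: \sum_(k < p) \sum_(l < q)
    ((-1) ^+ k * (-1) ^+ l / ((i + k * 2 + (j + l * 2)).+2%:R *
       (k`!%:R * (i.+1 + k)`!%:R) * (l`!%:R * (j.+1 + l)`!%:R))) *: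
      'X^((i + k * 2 + (j + l * 2)).+2).

Lemma deriv_Kpoly N (i j : 'I_N) s :
  (Kpoly i j (N - i) (N - j))^`().[s] = s * (vvec N s i 0 * vvec N s j 0).
Proof.
rewrite !mxE /Kpoly derivZ hornerZ [in RHS]mulrACA (mulrCA s); congr (_ * _).
rewrite raddf_sum horner_sum mulr_suml mulr_sumr; apply: eq_bigr => k _ /=.
rewrite raddf_sum horner_sum mulr_sumr mulr_sumr; apply: eq_bigr => l _ /=.
rewrite derivZ hornerZ derivXn hornerMn hornerXn /= exprS exprD /bessel_term.
rewrite -(mulr_natr (_ * _)).
have f0 q : q`!%:R != 0 :> R by rewrite pnatr_eq0 -lt0n fact_gt0.
have : (i + k * 2 + (j + l * 2)).+2%:R != 0 :> R by rewrite pnatr_eq0.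
move: (f0 k) (f0 l) (f0 (i.+1 + k)%N) (f0 (j.+1 + l)%N).
move: (_.+2%:R : R) => m.
move: (k`!%:R : R) (l`!%:R : R) ((i.+1 + k)`!%:R : R) ((j.+1 + l)`!%:R : R).
move: (s ^+ _) (s ^+ _) ((-1) ^+ k) ((-1) ^+ l) => a b c d e f g h e0 g0 h0 k0 m0.
by field; rewrite e0 g0 h0 k0 m0.
Qed.

Lemma Kmx_Kpoly_bound N (i j : 'I_N) T : 0 < T ->
  `|Kmx N T i j - (Kpoly i j (N - i) (N - j)).[T]| <=
  T * (trunc_err (1 + T) N *
   (Num.sqrt i.+1%:R * ((1 + T) ^+ i * expR ((1 + T) ^+ 2)) +
    Num.sqrt j.+1%:R * ((1 + T) ^+ j * expR ((1 + T) ^+ 2)) + trunc_err (1 + T) N)) * T.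
Proof.
move=> T0; set p := Kpoly _ _ _ _.
pose f : R -> R := (fun s : R => Kmx N s i j) - (horner p : R -> R).
have f0 : f 0 = 0.
  rewrite /f fctE /Kmx /Gmx Lmx0 addr0 invmx1 subrr mxE sub0r.
  apply/eqP; rewrite oppr_eq0 /p /Kpoly hornerZ; apply/eqP.
  rewrite horner_sum big1 ?mulr0// => k _; rewrite horner_sum big1// => l _.
  by rewrite hornerZ hornerXn exprS mul0r mulr0.
have fd (x : R) : is_derive x 1 f (x * ((Gmx N x *m uvec N x) i 0 *
  (Gmx N x *m uvec N x) j 0
    - vvec N x i 0 * vvec N x j 0)).
  have := is_derive_Kmx x i j => d1.
  by rewrite /f; apply: is_derive_eq; rewrite deriv_Kpoly mulrBr.
have -> : Kmx N T i j - p.[T] = f T - f 0 by rewrite f0 subr0.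
apply: (@derivative_bound _ _ _ _ T0 (fun x _ => fd x)).
- apply: derivable_within_continuous => x _; exact: ex_derive.
- move=> x /andP[x0 xT]; rewrite normrM (gtr0_norm x0).
  apply: ler_pM => //; [exact: ltW|exact: ltW|].
  apply: norm_mul_Gmx_uvec; first by rewrite lerDl ltW.
  by rewrite gtr0_norm// (le_trans (ltW xT))// lerDr.
Qed.

End limits.

(** * Euler's Gamma function *)

Section gamma.
Context {R : realType}.
Notation mu := (@lebesgue_measure R).

Definition euler_fun (s t : R) : R := t `^ (s - 1) * expR (- t).

(** Extended values let the functional equation be proved before finiteness. *)
Definition eGamma (s : R) : \bar R := (\int[mu]_(t in `]0%R, +oo[) (euler_fun s t)%:E)%E.

Lemma euler_fun_ge0 s t : 0 <= euler_fun s t.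
Proof. by rewrite mulr_ge0 ?powR_ge0 ?expR_ge0. Qed.

Lemma measurable_euler_fun s (D : set R) : measurable_fun D (euler_fun s).
Proof.
apply: measurable_funTS; apply: measurable_funM; first exact: measurable_powR.
by apply: measurableT_comp => //; exact: measurable_expR.
Qed.

(** One term of the exponential series is at most its sum. *)
Lemma powR_expR_bound (k : nat) (x : R) : 0 < x -> x ^+ k * expR (- x) <= k.+1`!%:R / x.
Proof.
move=> x0; rewrite expRN.
rewrite ler_pdivrMr ?expR_gt0// mulrAC ler_pdivlMr//.
have := expR_ge1Dxn k (ltW x0); have f0 : 0 < k.+1`!%:R :> R by rewrite ltr0n fact_gt0.
move=> /(le_trans _) h; rewrite -ler_pdivrMl// mulrC -exprSr; apply: h.
by rewrite lerDr.
Qed.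

Let a_ (n : nat) : R := n.+2%:R^-1.
Let b_ (n : nat) : R := n.+2%:R.

Let a_gt0 n : 0 < a_ n. Proof. by rewrite invr_gt0. Qed.
Let ab n : a_ n < b_ n.
Proof.
apply: (@lt_trans _ _ 1); first by rewrite invf_lt1// ltr1n.
by rewrite ltr1n.
Qed.

(** Monotone convergence along the compact intervals [1/(n+2), n+2]. *)
Let eGamma_cvg s :
  (\int[mu]_(t in `[a_ n, b_ n]) (euler_fun s t)%:E)%E @[n --> \oo] --> eGamma s.
Proof.
rewrite /eGamma; have -> : `]0%R, +oo[%classic = \bigcup_n `[a_ n, b_ n]%classic.
  apply/seteqP; split => t /=; rewrite in_itv /= ?andbT => t0.
    pose m := (Num.truncn t + Num.truncn t^-1)%N; exists m => //=; rewrite in_itv /=.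
    have ti0 : 0 < t^-1 by rewrite invr_gt0.
    have h1 := truncnS_gt t; have h2 := truncnS_gt t^-1.
    apply/andP; split.
      rewrite -[t]invrK lef_pV2 ?posrE//; apply: (le_trans (ltW h2)).
      by rewrite ler_nat leqW// ltnS leq_addl.
    by apply: (le_trans (ltW h1)); rewrite ler_nat leqW// ltnS leq_addr.
  by case: t0 => n _ /=; rewrite in_itv /= => /andP[/(lt_le_trans (a_gt0 n))->].
apply: ge0_nondecreasing_set_cvg_integral => //.
- apply/nondecreasing_seqP => n; rewrite subsetEset.
  apply: subset_itv; rewrite bnd_simp /a_ /b_.
    by rewrite lef_pV2 ?posrE// ler_nat.
  by rewrite ler_nat.
- move=> i; apply/measurable_EFinP; exact: measurable_euler_fun.
- by move=> i x _; rewrite lee_fin euler_fun_ge0.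
Qed.

Let bound s n : R := a_ n `^ s * expR (- a_ n) - b_ n `^ s * expR (- b_ n).

(** Integration takes place away from 0, since for [s < 1] the integrand of
[Gamma s] is unbounded there. *)
Let by_parts s n :
  (\int[mu]_(t in `[a_ n, b_ n]) (euler_fun (s + 1) t)%:E =
   (bound s n)%:E + s%:E * \int[mu]_(t in `[a_ n, b_ n]) (euler_fun s t)%:E)%E.
Proof.
have pos x : x \in `[a_ n, b_ n] -> 0 < x.
  by rewrite in_itv /= => /andP[/(lt_le_trans (a_gt0 n))].
have cpow r : {within `[a_ n, b_ n], continuous ((@powR R) ^~ r)}.
  apply: derivable_within_continuous => x /pos x0.
  by apply: ex_derive; exact: is_derive1_powR.
have cexp : {within `[a_ n, b_ n], continuous (fun t => expR (- t))}.
  by apply: derivable_within_continuous => x /pos x0.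
have lr (f : R -> R) : {in `[a_ n, b_ n], forall x, derivable f x 1} ->
    derivable_oo_LRcontinuous f (a_ n) (b_ n).
  move=> df; split.
  - by move=> x xab; apply: df; exact: subset_itv_oo_cc.
  - apply: cvg_at_right_filter; apply: differentiable_continuous.
    by apply/derivable1_diffP/df; rewrite in_itv /= lexx ltW.
  - apply: cvg_at_left_filter; apply: differentiable_continuous.
    by apply/derivable1_diffP/df; rewrite in_itv /= lexx ltW.
have := @integration_by_parts R ((@powR R) ^~ s) (fun t => - expR (- t))
  (fun t => s * t `^ (s - 1)) (fun t => expR (- t)) (a_ n) (b_ n) (ab n).
have ie : mu.-integrable `[a_ n, b_ n] (EFin \o euler_fun s).
  apply: continuous_compact_integrable; first exact: segment_compact.
  move=> x; apply: cvgM; first exact: cpow.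
  exact: cexp.
rewrite {1}/euler_fun addrK => ->.
- under eq_integral => t _.
    rewrite (_ : _ * _ = - s * euler_fun s t); last by rewrite /euler_fun; ring.
    rewrite EFinM; over.
  rewrite integralZl// EFinN mulNe oppeK /bound; congr (_%:E + _)%E; ring.
- move=> x; apply: cvgM; [exact: cvg_cst|exact: cpow].
- apply: lr => x /pos x0; by apply: ex_derive; exact: is_derive1_powR.
- move=> x /subset_itv_oo_cc /pos x0; rewrite derive1E.
  have h := is_derive1_powR s x0.
  by rewrite derive_val.
- exact: cexp.
- apply: lr => x /pos x0; exact: ex_derive.
- move=> x _; rewrite derive1E derive_val /GRing.scale /=; ring.
Qed.

Let a_cvg : a_ @ \oo --> (0 : R).
Proof.
rewrite (_ : a_ = (fun n => harmonic (n + 1)%N)); last first.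
  by apply/funext => n; rewrite /a_ addn1.
by rewrite cvg_shiftn; exact: cvg_harmonic.
Qed.

(** At the left end the power tends to 0; at the right end the exponential wins. *)
Let bound0 s : 0 < s -> bound s @ \oo --> (0 : R).
Proof.
move=> s0; rewrite -[X in _ --> X]subr0; apply: cvgB.
  rewrite -[X in _ --> X](mul0r (expR (- 0) : R)); apply: cvgM.
    by have := powR_cvg0 s0 => /cvg_at_rightP; apply; split.
  apply: continuous_cvg; first exact: continuous_expR.
  exact: cvgN.
(* An integer exponent above [s], to compare with a term of the series. *)
pose k := (Num.truncn s).+1.
apply: (@squeeze_cvgr _ _ _ _ (fun=> 0) (fun n => k.+1`!%:R * a_ n)).
- apply: nearW => n; rewrite mulr_ge0 ?powR_ge0 ?expR_ge0//=.
  have b0 : 0 < b_ n by exact: lt_trans (a_gt0 n) (ab n).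
  apply: (le_trans _ (powR_expR_bound k b0)); rewrite ler_wpM2r ?expR_ge0//.
  rewrite -powR_mulrn ?(ltW b0)//; apply: ler_powR; first by rewrite ler1n.
  by apply/ltW; exact: truncnS_gt.
- exact: cvg_cst.
- rewrite -[X in _ --> X](mulr0 (k.+1`!%:R : R)); apply: cvgM => //; exact: cvg_cst.
Qed.

Lemma eGammaS s : 0 < s -> eGamma (s + 1) = (s%:E * eGamma s)%E.
Proof.
move=> s0; have h1 := @eGamma_cvg (s + 1).
have h2 : (fun n => (bound s n)%:E + s%:E *
  \int[mu]_(t in `[a_ n, b_ n]) (euler_fun s t)%:E)%E
    @ \oo --> (0%:E + s%:E * eGamma s)%E.
  apply: cvgeD.
  - by rewrite /adde_def.
  - by apply: cvg_EFin; [exact: nearW|exact: bound0].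
  - by apply: cvgeZl => //; exact: eGamma_cvg.
rewrite add0e in h2.
have e : (fun n => \int[mu]_(t in `[a_ n, b_ n]) (euler_fun (s + 1) t)%:E)%E =
  (fun n => (bound s n)%:E + s%:E * \int[mu]_(t in `[a_ n, b_ n]) (euler_fun s t)%:E)%E.
  by apply/funext => n; exact: by_parts.
by rewrite e in h1; exact: cvg_unique h1 h2.
Qed.

Lemma eGamma1 : eGamma 1 = 1%E.
Proof.
rewrite /eGamma; under eq_integral do rewrite /euler_fun subrr powRr0 mul1r.
rewrite integral_itv_obnd_cbnd; last first.
  by apply/measurable_EFinP; apply: measurable_funTS; apply: measurableT_comp => //;
    exact: measurable_expR.
rewrite (@ge0_continuous_FTC2y _ _ (fun t => - expR (- t)) _ 0).
- by rewrite oppr0 expR0 EFinN oppeK add0e.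
- by move=> x _; exact: expR_ge0.
- by apply: continuous_subspaceT => x; apply: continuous_comp;
    [exact: continuousN|exact: continuous_expR].
- rewrite -oppr0; apply: cvgN; exact: cvgr_expR.
- by move=> x _; exact: ex_derive.
- apply: cvg_at_right_filter; apply: cvgN.
  by apply: continuous_comp; [exact: continuousN|exact: continuous_expR].
- move=> x _; rewrite derive1E derive_val; by rewrite /GRing.scale /=; ring.
Qed.

Lemma eGamma_nat n : eGamma n.+1%:R = (n`!%:R)%:E.
Proof.
elim: n => [|n IH]; first by rewrite eGamma1 fact0.
by rewrite -addn1 natrD eGammaS ?ltr0n// IH -EFinM factS natrM.
Qed.

Lemma GammaE (s : R) : Gamma s = fine (eGamma s).
Proof. by []. Qed.

Lemma GammaS (s : R) : 0 < s -> Gamma (s + 1) = s * Gamma s.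
Proof.
move=> s0; rewrite !GammaE eGammaS//; case: (eGamma s) => [r| |] //=.
- by rewrite gt0_muley ?lte_fin// mulr0.
- by rewrite gt0_muleNy ?lte_fin// mulr0.
Qed.

Lemma Gamma_nat n : Gamma n.+1%:R = n`!%:R :> R.
Proof. by rewrite GammaE eGamma_nat. Qed.

(** Dominated convergence: for [s] between [n + 1] and [n + 3] the integrand is at
most the sum of the integrands at these two integers. *)
Lemma Gamma_cvg_nat (n : nat) : (Gamma s : R) @[s --> (n.+2%:R : R)] --> (n.+1`!%:R : R).
Proof.
rewrite -Gamma_nat.
pose g t := euler_fun n.+1%:R t + euler_fun n.+3%:R t.
have int_nat k : mu.-integrable `]0%R, +oo[ (EFin \o euler_fun k.+1%:R).
  apply/integrableP; split; first by apply/measurable_EFinP; exact: measurable_euler_fun.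
  under eq_integral => t _ do rewrite /= ger0_norm ?euler_fun_ge0//.
  by rewrite -/(eGamma k.+1%:R) eGamma_nat ltry.
have int_g : mu.-integrable `]0%R, +oo[ (EFin \o g).
  rewrite (_ : EFin \o g = (EFin \o euler_fun n.+1%:R) \+
    (EFin \o euler_fun n.+3%:R))%E//.
  exact: integrableD.
have dom s t : n.+1%:R < s < n.+3%:R -> 0 < t -> `|euler_fun s t| <= g t.
  move=> /andP[s1 s2] t0; rewrite ger0_norm ?euler_fun_ge0// /g /euler_fun -mulrDl.
  rewrite ler_wpM2r ?expR_ge0//.
  have [t1|t1] := leP 1 t.
    by apply: ler_wpDl; rewrite ?powR_ge0// ler_powR// lerB// ltW.
  apply: ler_wpDr; rewrite ?powR_ge0//; apply: ger_powR; first by rewrite t0 ltW.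
  by rewrite lerB// ltW.
have := @continuity_under_integral R _ _ mu euler_fun `]0%R,
  +oo[ _ n.+1%:R n.+3%:R _ _ g int_g _ n.+2%:R.
apply => //.
- move=> s /= sI; apply: le_integrable int_g => //.
    by apply/measurable_EFinP; exact: measurable_euler_fun.
  move=> t /=; rewrite in_itv /= andbT => t0; rewrite lee_fin.
  rewrite in_itv /= in sI.
  by rewrite [leRHS]ger0_norm ?dom// addr_ge0// euler_fun_ge0.
- apply: aeW => t /=; rewrite in_itv /= andbT => t0 s _.
  rewrite /euler_fun; apply: cvgM; last exact: cvg_cst.
  have h : continuous (fun l : R => t `^ (l - 1)).
    rewrite (_ : (fun l => _) = (fun l => expR ((l - 1) * ln t))); last first.
      by apply/funext => l; rewrite /powR gt_eqF.
    move=> l; apply: continuous_comp; last exact: continuous_expR.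
    apply: cvgM; last exact: cvg_cst.
    by apply: cvgB; [exact: cvg_id|exact: cvg_cst].
  exact: h.
- move=> s /= sI; apply: aeW => t /=; rewrite in_itv /= andbT => t0.
  by rewrite in_itv /= in sI; exact: dom.
- by rewrite inE /= in_itv /= !ltr_nat !ltnS leqnn.
Qed.

End gamma.

(** * The Bessel kernel as a double series *)

Section bessel.
Context {R : realType}.
Variable t : R.
Hypothesis t_gt0 : 0 < t.

Let t2_ge0 : 0 <= t ^+ 2. Proof. exact: sqr_ge0. Qed.

(** The terms of the series of [J_y(2t)], normalized so that the first one is 1:
for [y > 0] what remains of [y] is a product of positive factors in the
denominator, and no Gamma function. *)
Definition bessel_coef (y : R) (k : nat) : R :=
  (-1) ^+ k * t ^+ 2 ^+ k / (k`!%:R * \prod_(m < k) (y + 1 + m%:R)).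

Lemma prod_shift_ge1 (y : R) k : 0 < y -> 1 <= \prod_(m < k) (y + 1 + m%:R).
Proof.
move=> y0; elim/big_rec: _ => // i x _ x1; rewrite -[leLHS]mulr1 ler_pM//.
by rewrite -addrA [1 + _]addrC addrA lerDr addr_ge0// ltW.
Qed.

Lemma norm_bessel_coef y k : 0 < y -> `|bessel_coef y k| <= exp_coeff (t ^+ 2) k.
Proof.
move=> y0; rewrite /bessel_coef /exp_coeff /= !normrM normrX normrN1 expr1n mul1r.
rewrite (ger0_norm (exprn_ge0 k t2_ge0)); apply: ler_wpM2l; first exact: exprn_ge0.
rewrite normfV.
have h := prod_shift_ge1 k y0.
rewrite ger0_norm; last by rewrite mulr_ge0// (le_trans ler01).
rewrite lef_pV2 ?posrE ?mulr_gt0 ?ltr0n ?fact_gt0 ?(lt_le_trans ltr01)//.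
by rewrite ler_peMr.
Qed.

(** The recursion that makes the double sum telescope. *)
Lemma bessel_coefS y k : 0 < y ->
  k.+1%:R * (y + k.+1%:R) * bessel_coef y k.+1 = - t ^+ 2 * bessel_coef y k.
Proof.
move=> y0; rewrite /bessel_coef big_ord_recr /= !exprS factS natrM.
have : \prod_(m < k) (y + 1 + m%:R) != 0.
  by rewrite gt_eqF// (lt_le_trans ltr01)// prod_shift_ge1.
have : k`!%:R != 0 :> R by rewrite pnatr_eq0 -lt0n fact_gt0.
have : k.+1%:R != 0 :> R by rewrite pnatr_eq0.
have : y + k.+1%:R != 0 by rewrite gt_eqF// addr_gt0.
rewrite -[k.+1]add1n natrD addrA.
move: (\prod_(m < k) _) (k`!%:R : R) (k%:R : R) => a b c h1 h2 h3 h4.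
by field; rewrite h1 h2 h3 h4.
Qed.

Lemma cvg_bessel_coef y : 0 < y -> cvgn (series (bessel_coef y)).
Proof.
move=> y0; apply: normed_cvg; apply: (series_le_cvg _ _ _
  (is_cvg_series_exp_coeff (t ^+ 2))).
- by move=> n /=.
- by move=> n; rewrite exp_coeff_ge0.
- by move=> n; exact: norm_bessel_coef.
Qed.

(** The terms of the series of [2 t J_(y-1)(2t)], with the same normalization as for
[J_y(2t)]. *)
Definition bessel_pred_coef (y : R) (k : nat) : R := 2 * (y + k%:R) * bessel_coef y k.

Lemma cvg_bessel_pred_coef y : 0 < y -> cvgn (series (bessel_pred_coef y)).
Proof.
move=> y0; apply: normed_cvg.
apply: (@series_le_cvg _ _ (fun k => (2 * y + 2) * exp_coeff (2 * t ^+ 2) k)).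
- by move=> n /=.
- move=> n; apply: mulr_ge0; last by apply: exp_coeff_ge0; exact: mulr_ge0.
  by rewrite addr_ge0// mulr_ge0// ltW.
- move=> n; rewrite /= /bessel_pred_coef normrM ger0_norm;
    last by rewrite mulr_ge0// addr_ge0// ltW.
  rewrite /exp_coeff /= exprMn.
  apply: (@le_trans _ _ ((2 * y + 2) * 2 ^+ n * exp_coeff (t ^+ 2) n)).
    apply: ler_pM => //; [by rewrite mulr_ge0// addr_ge0// ltW| |exact: norm_bessel_coef].
    rewrite mulrDr (mulrDl (2 * y)) lerD//.
      by rewrite ler_peMr ?mulr_ge0 ?(ltW y0)// exprn_ege1// ler1n.
    by rewrite ler_wpM2l// nat_le_expn2.
  by rewrite /exp_coeff /= !mulrA.
- by apply: is_cvg_seriesZ; exact: is_cvg_series_exp_coeff.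
Qed.

Definition bessel_lead (y : R) : R := t `^ y / Gamma (y + 1).

Lemma rGamma_pos (y : R) : 0 < y -> rGamma y = (Gamma y)^-1.
Proof. by move=> y0; rewrite /rGamma y0 big_ord0 addr0 div1r. Qed.

Lemma Gamma_prod (y : R) k : 0 < y ->
  Gamma (y + k%:R + 1) = Gamma (y + 1) * \prod_(m < k) (y + 1 + m%:R).
Proof.
move=> y0; elim: k => [|k IH]; first by rewrite big_ord0 mulr1 addr0.
rewrite -addn1 natrD addrA GammaS; last by do 2! rewrite ltr_wpDr//.
rewrite IH addn1 big_ord_recr /= mulrC -mulrA; congr (_ * (_ * _)).
by rewrite addrAC.
Qed.

Let halfK : 2 * t / 2 = t. Proof. by rewrite mulrAC divff ?mul1r. Qed.

Lemma besselJ_series y : 0 < y ->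
  besselJ y (2 * t) = bessel_lead y * limn (series (bessel_coef y)).
Proof.
move=> y0.
have -> : bessel_lead y * limn (series (bessel_coef y)) =
  limn (series (bessel_lead y *: bessel_coef y)).
  by rewrite lim_seriesZ//; exact: cvg_bessel_coef.
rewrite /besselJ; congr (limn (series _)); apply/funext => k.
rewrite rGamma_pos; last by rewrite ltr_wpDl// addr_ge0// ltW.
rewrite Gamma_prod// halfK powRD; last by rewrite (gt_eqF t_gt0) implybT.
rewrite powR_mulrn ?(ltW t_gt0)// exprM /GRing.scale /= /bessel_coef /bessel_lead !invfM
  -[RHS]/(_ * _); ring.
Qed.

Lemma besselJ_pred_series y : 0 < y ->
  2 * t * besselJ (y - 1) (2 * t) = bessel_lead y * limn (series (bessel_pred_coef y)).
Proof.
move=> y0.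
have -> : bessel_lead y * limn (series (bessel_pred_coef y)) =
  limn (series (bessel_lead y *: bessel_pred_coef y)).
  by rewrite lim_seriesZ//; exact: cvg_bessel_pred_coef.
pose f k : R := (-1) ^+ k / k`!%:R * rGamma (y - 1 + k%:R + 1) *
    (2 * t / 2) `^ (y - 1 + (2 * k)%:R).
rewrite -[besselJ _ _]/(limn (series f)).
have fE k : bessel_lead y * bessel_pred_coef y k = 2 * t * f k.
  rewrite /f halfK.
  have yk : 0 < y + k%:R by rewrite ltr_wpDr.
  have -> : y - 1 + k%:R + 1 = y + k%:R by rewrite addrAC subrK.
  rewrite rGamma_pos// addrAC powRB; last by rewrite (gt_eqF t_gt0) implybT.
  rewrite powRD; last by rewrite (gt_eqF t_gt0) implybT.
  rewrite powR_mulrn ?(ltW t_gt0)// powRr1 ?(ltW t_gt0)// exprM /bessel_pred_coef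
    /bessel_coef /bessel_lead.
  have := Gamma_prod k y0; rewrite GammaS// => h.
  have -> : (Gamma (y + k%:R))^-1 =
      (y + k%:R) / (Gamma (y + 1) * \prod_(m < k) (y + 1 + m%:R)).
    by rewrite -h invfM mulrA divff ?mul1r// gt_eqF.
  rewrite !invfM; move: (_^-1) (_^-1) (_^-1) => a b c.
  have : t != 0 by rewrite gt_eqF.
  by move=> t0; field.
have -> : bessel_lead y *: bessel_pred_coef y = (2 * t) *: f by apply/funext => k;
  exact: fE.
rewrite lim_seriesZ//.
have -> : f = (2 * t)^-1 *: (bessel_lead y *: bessel_pred_coef y).
  apply/funext => k; rewrite -[RHS]/(_ * (_ * _)) fE mulrA mulVf ?mul1r//.
  by rewrite gt_eqF// mulr_gt0.
by do 2! apply: is_cvg_seriesZ; exact: cvg_bessel_pred_coef.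
Qed.

(** Up to a factor, a partial sum of the integral of [J_x(2s) J_y(2s) ds / s]. *)
Definition dsum (p q : nat) (x y : R) : R :=
  \sum_(k < p) \sum_(l < q) bessel_coef x k * bessel_coef y l / (x + y + 2 * (k + l)%:R).

Definition dlim (x y : R) : R := limn (fun N => dsum N N x y).

Definition expR_tail (n : nat) : R := expR (t ^+ 2) - series (exp_coeff (t ^+ 2)) n.

Lemma cvg_expR_tail : expR_tail @ \oo --> (0 : R).
Proof.
rewrite -(subrr (expR (t ^+ 2))); apply: cvgB; first exact: cvg_cst.
exact: is_cvg_series_exp_coeff.
Qed.

Lemma cvg_expR_tail2 (c : R) : (fun N => c * (expR_tail N + expR_tail N)) @ \oo -->
  (0 : R).
Proof.
have h : (fun N => c * (expR_tail N + expR_tail N)) @ \oo --> c * (0 + 0).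
  by apply: cvgM; [exact: cvg_cst|apply: cvgD; exact: cvg_expR_tail].
by rewrite addr0 mulr0 in h.
Qed.

Lemma series_exp_le n : series (exp_coeff (t ^+ 2)) n <= expR (t ^+ 2).
Proof.
rewrite /series /= big_mkord; apply: sum_exp_coeff_le.
by rewrite exprn_ge0// ltW.
Qed.

Lemma expR_tail_ge0 n : 0 <= expR_tail n.
Proof. by rewrite subr_ge0 series_exp_le. Qed.

Lemma norm_dterm x y k l : 0 < x -> 0 < y ->
  `|bessel_coef x k * bessel_coef y l / (x + y + 2 * (k + l)%:R)| <=
  exp_coeff (t ^+ 2) k * exp_coeff (t ^+ 2) l / (x + y).
Proof.
move=> x0 y0; have xy : 0 < x + y by rewrite addr_gt0.
rewrite 2!normrM normfV; apply: ler_pM; rewrite ?mulr_ge0//.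
  by apply: ler_pM => //; exact: norm_bessel_coef.
rewrite ger0_norm; last by rewrite addr_ge0 ?(ltW xy)// mulr_ge0.
by rewrite lef_pV2 ?posrE// ?lerDl ?mulr_ge0// ltr_wpDr ?mulr_ge0.
Qed.

(** The two sums differ by terms with a large first or a large second index; each
term is at most a product of terms of the exponential series, for all positive
[x] and [y]. *)
Lemma dsum_diff p q p' q' x y : 0 < x -> 0 < y -> (p <= p')%N -> (q <= q')%N ->
  `|dsum p' q' x y - dsum p q x y| <= expR (t ^+ 2) /
    (x + y) * (expR_tail p + expR_tail q).
Proof.
move=> x0 y0 pp qq; have xy : 0 < x + y by rewrite addr_gt0.
pose T k l := bessel_coef x k * bessel_coef y l / (x + y + 2 * (k + l)%:R).
pose al := exp_coeff (t ^+ 2).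
have al0 k : 0 <= al k by exact: exp_coeff_ge0.
have TB (r1 r2 : seq nat) : `|\sum_(k <- r1) \sum_(l <- r2) T k l| <=
    (\sum_(k <- r1) al k) * (\sum_(l <- r2) al l) / (x + y).
  apply: (le_trans (ler_norm_sum _ _ _)).
  rewrite !mulr_suml; apply: ler_sum => k _.
  apply: (le_trans (ler_norm_sum _ _ _)).
  rewrite mulr_sumr mulr_suml; apply: ler_sum => l _; exact: norm_dterm.
have HT a b : dsum a b x y = \sum_(0 <= k < a) \sum_(0 <= l < b) T k l.
  by rewrite big_mkord; apply: eq_bigr => k _; rewrite big_mkord.
have tail a b : (a <= b)%N -> \sum_(a <= k < b) al k <= expR_tail a.
  move=> ab; rewrite /expR_tail lerBrDr /series /= addrC -big_cat_nat//=.
  exact: series_exp_le.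
have head a : \sum_(0 <= k < a) al k <= expR (t ^+ 2) by exact: series_exp_le.
have sum0 a b : 0 <= \sum_(a <= k < b) al k by apply: sumr_ge0.
have -> : dsum p' q' x y - dsum p q x y =
    \sum_(p <= k < p') \sum_(0 <= l < q') T k l +
      \sum_(0 <= k < p) \sum_(q <= l < q') T k l.
  rewrite !HT (big_cat_nat (leq0n p) pp)//= addrAC addrC; congr (_ + _).
  rewrite -sumrB; apply: eq_bigr => k _; by rewrite (big_cat_nat (leq0n q) qq)//= addrAC
    subrr add0r.
apply: (le_trans (ler_normD _ _)); rewrite mulrDr lerD//.
  apply: (le_trans (TB _ _)); rewrite [leRHS]mulrAC ler_wpM2r ?invr_ge0 ?(ltW xy)// mulrC.
  by apply: ler_pM; rewrite ?sum0 ?head ?tail.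
apply: (le_trans (TB _ _)); rewrite [leRHS]mulrAC ler_wpM2r ?invr_ge0 ?(ltW xy)//.
by apply: ler_pM; rewrite ?sum0 ?head ?tail.
Qed.

Lemma cvg_dsum x y : 0 < x -> 0 < y -> cvgn (fun N => dsum N N x y).
Proof.
move=> x0 y0; apply: cauchy_cvg; apply: cauchy_exP => e e0.
have h0 := cvg_expR_tail2 (expR (t ^+ 2) / (x + y)).
move: h0 => /cvgrPdist_lt /(_ _ e0)[N _ /(_ N (leqnn N))] /= h.
exists (dsum N N x y); exists N => // M /= NM.
rewrite /ball /= distrC; apply: (le_lt_trans (dsum_diff x0 y0 NM NM)).
by apply: le_lt_trans h; rewrite sub0r normrN ler_norm.
Qed.

Lemma dsum_dlim p q x y : 0 < x -> 0 < y ->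
  `|dlim x y - dsum p q x y| <= expR (t ^+ 2) / (x + y) * (expR_tail p + expR_tail q).
Proof.
move=> x0 y0; have h := @cvg_dsum x y x0 y0.
have h' : (fun N => `|dsum N N x y - dsum p q x y|) @ \oo --> `|dlim x y - dsum p q x y|.
  by apply: cvg_norm; apply: cvgB => //; exact: cvg_cst.
rewrite -(cvg_lim _ h')//; apply: limr_le; first by apply/cvg_ex; eexists; exact: h'.
exists (maxn p q) => // N /=; rewrite geq_max => /andP[pN qN].
exact: dsum_diff.
Qed.

(** By the recursion for the coefficients, [U (k+1) l] and [V k (l+1)] in the
proof both equal [- W k l].  Hence the sums of [U] and of [V] over a rectangle cancel
  except
along its two far edges. *)
Lemma dsum_telescope P Q x y : 0 < x -> 0 < y ->
  (\sum_(k < P.+1) bessel_pred_coef x k) * (\sum_(l < Q.+1) bessel_coef y l) -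
  (\sum_(l < Q.+1) bessel_pred_coef y l) * (\sum_(k < P.+1) bessel_coef x k) -
  (x - y) * (\sum_(k < P.+1) bessel_coef x k) * (\sum_(l < Q.+1) bessel_coef y l) =
  (x ^+ 2 - y ^+ 2) * dsum P.+1 Q.+1 x y +
  4 * t ^+ 2 * (\sum_(l < Q) bessel_coef x P * bessel_coef y l /
    (x + y + 2 * (P + l).+1%:R) -
                \sum_(k < P) bessel_coef x k * bessel_coef y Q /
                  (x + y + 2 * (k + Q).+1%:R)).
Proof.
move=> x0 y0; pose D n := x + y + 2 * n%:R.
have D0 n : D n != 0 by rewrite gt_eqF// ltr_wpDr ?mulr_ge0// addr_gt0.
pose U k l := 4 * (k%:R * (x + k%:R) * bessel_coef x k) * bessel_coef y l / D (k + l)%N.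
pose V k l := 4 * bessel_coef x k * (l%:R * (y + l%:R) * bessel_coef y l) / D (k + l)%N.
pose W k l := 4 * t ^+ 2 * (bessel_coef x k * bessel_coef y l / D (k + l).+1).
have U0 l : U 0%N l = 0 by rewrite /U !mul0r mulr0 !mul0r.
have V0 k : V k 0%N = 0 by rewrite /V !mul0r mulr0 !mul0r.
have US k l : U k.+1 l = - W k l by rewrite /U bessel_coefS// addSn /W; ring.
have VS k l : V k l.+1 = - W k l by rewrite /V bessel_coefS// addnS /W; ring.
(* The identity between the factors of [a_k b_l], over the denominator [D]. *)
have key k l : bessel_pred_coef x k * bessel_coef y l - bessel_pred_coef y l *
  bessel_coef x k - (x - y) * bessel_coef x k * bessel_coef y l =
    (x ^+ 2 - y ^+ 2) * (bessel_coef x k * bessel_coef y l / D (k + l)%N) +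
      (U k l - V k l).
  rewrite /bessel_pred_coef /U /V; have := D0 (k + l)%N; rewrite /D natrD.
  move: (bessel_coef x k) (bessel_coef y l) => a b h; field; exact: h.
have -> : 4 * t ^+ 2 * (\sum_(l < Q) bessel_coef x P * bessel_coef y l /
  (x + y + 2 * (P + l).+1%:R) -
          \sum_(k < P) bessel_coef x k * bessel_coef y Q / (x + y + 2 * (k + Q).+1%:R)) =
   \sum_(l < Q) W P l - \sum_(k < P) W k Q by rewrite mulrBr !mulr_sumr.
have eU : \sum_(k < P.+1) \sum_(l < Q.+1) U k l =
    - (\sum_(k < P) \sum_(l < Q) W k l + \sum_(k < P) W k Q).
  rewrite big_ord_recl big1 ?add0r => [|l _]; last exact: U0.
  rewrite -big_split -sumrN; apply: eq_bigr => k _ /=.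
  transitivity (\sum_(l < Q.+1) - W k l); first by apply: eq_bigr => l _; exact: US.
  by rewrite sumrN big_ord_recr.
have eV : \sum_(k < P.+1) \sum_(l < Q.+1) V k l =
    - (\sum_(k < P) \sum_(l < Q) W k l + \sum_(l < Q) W P l).
  transitivity (\sum_(k < P.+1) \sum_(l < Q) - W k l).
    apply: eq_bigr => k _; rewrite big_ord_recl V0 add0r.
    by apply: eq_bigr => l _; exact: VS.
  under eq_bigr do rewrite sumrN.
  by rewrite sumrN big_ord_recr.
have -> : \sum_(l < Q) W P l - \sum_(k < P) W k Q =
    \sum_(k < P.+1) \sum_(l < Q.+1) U k l - \sum_(k < P.+1) \sum_(l < Q.+1) V k l.
  by rewrite eU eV; ring.
rewrite [(\sum_(l < Q.+1) bessel_pred_coef y l) * _]mulrC -[(x - y) * _ * _]mulrA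
  !big_distrlr /= /dsum !mulr_sumr -!sumrB -big_split.
apply: eq_bigr => k _ /=; rewrite !mulr_sumr -!sumrB -big_split.
apply: eq_bigr => l _ /=; by rewrite -key; ring.
Qed.

Lemma dlim_bessel x y : 0 < x -> 0 < y ->
  (x ^+ 2 - y ^+ 2) * dlim x y =
  limn (series (bessel_pred_coef x)) * limn (series (bessel_coef y)) -
  limn (series (bessel_pred_coef y)) * limn (series (bessel_coef x)) -
  (x - y) * limn (series (bessel_coef x)) * limn (series (bessel_coef y)).
Proof.
move=> x0 y0; have xy : 0 < x + y by rewrite addr_gt0.
pose sa z n := series (bessel_coef z) n.+1;
  pose sb z n := series (bessel_pred_coef z) n.+1.
pose u n := sb x n * sa y n - sb y n * sa x n - (x - y) * sa x n * sa y n.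
pose h n := dsum n.+1 n.+1 x y.
have shift (f : R^nat) : cvgn f -> (fun n => f n.+1) @ \oo --> limn f.
  by move=> cf; rewrite -(cvg_shiftS f) in cf *.
have cu : u @ \oo --> limn (series (bessel_pred_coef x)) * limn (series (bessel_coef y)) -
    limn (series (bessel_pred_coef y)) * limn (series (bessel_coef x)) -
    (x - y) * limn (series (bessel_coef x)) * limn (series (bessel_coef y)).
  have ca z : 0 < z -> sa z @ \oo --> limn (series (bessel_coef z)).
    by move=> z0; apply: shift; exact: cvg_bessel_coef.
  have cb z : 0 < z -> sb z @ \oo --> limn (series (bessel_pred_coef z)).
    by move=> z0; apply: shift; exact: cvg_bessel_pred_coef.
  apply: cvgB; last by apply: cvgM; [apply: cvgM; [exact: cvg_cst|exact: ca]|exact: ca].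
  by apply: cvgB; apply: cvgM; [exact: cb|exact: ca|exact: cb|exact: ca].
have ch : (fun n => (x ^+ 2 - y ^+ 2) * h n) @ \oo --> (x ^+ 2 - y ^+ 2) * dlim x y.
  by apply: cvgM; [exact: cvg_cst|apply: shift; exact: cvg_dsum].
(* Dominates the two boundary sums left by the telescoping together. *)
pose b n := 8 * t ^+ 2 * expR (t ^+ 2) / (x + y) * exp_coeff (t ^+ 2) n.
have b0 : b @ \oo --> (0 : R).
  have hb : b @ \oo --> 8 * t ^+ 2 * expR (t ^+ 2) / (x + y) * 0.
    by apply: cvgM; [exact: cvg_cst|exact: cvg_exp_coeff].
  by rewrite mulr0 in hb.
have D0 n : 0 < x + y + 2 * n%:R by rewrite ltr_wpDr ?mulr_ge0.
have bnd z w n (F : nat -> nat) : 0 < z -> 0 < w ->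
    \sum_(l < n) `|bessel_coef z n * bessel_coef w l / (x + y + 2 * (F l)%:R)| <=
    exp_coeff (t ^+ 2) n * (expR (t ^+ 2) / (x + y)).
  move=> z0 w0; apply: (@le_trans _ _ (exp_coeff (t ^+ 2) n *
      ((\sum_(l < n) exp_coeff (t ^+ 2) l) / (x + y)))).
    rewrite mulr_suml mulr_sumr; apply: ler_sum => l _.
    rewrite 2!normrM -mulrA normfV; apply: ler_pM; rewrite ?mulr_ge0 ?norm_bessel_coef//.
    apply: ler_pM; rewrite ?norm_bessel_coef//.
    by rewrite gtr0_norm// lef_pV2 ?posrE// lerDl mulr_ge0.
  rewrite ler_wpM2l ?exp_coeff_ge0// ler_wpM2r ?invr_ge0 ?(ltW xy)//.
  exact: sum_exp_coeff_le.
have cd : u @ \oo --> (x ^+ 2 - y ^+ 2) * dlim x y.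
  have d0 : (u \- (fun n => (x ^+ 2 - y ^+ 2) * h n)) @ \oo --> (0 : R).
    apply: (@cvg_dist_bound R _ _ _ _ b _ _ b0); apply: nearW => n; rewrite subr0 /=.
    have -> : u n = (x ^+ 2 - y ^+ 2) * h n + 4 * t ^+ 2 *
      (\sum_(l < n) bessel_coef x n * bessel_coef y l / (x + y + 2 * (n + l).+1%:R) -
       \sum_(k < n) bessel_coef x k * bessel_coef y n / (x + y + 2 * (k + n).+1%:R)).
      rewrite -dsum_telescope// /u /sa /sb /series /= !big_mkord.
      by [].
    have c0 : 0 <= 4 * t ^+ 2 by exact: mulr_ge0.
    rewrite addrAC subrr add0r normrM (ger0_norm c0).
    apply: (@le_trans _ _ (4 * t ^+ 2 * (exp_coeff (t ^+ 2) n *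
      (expR (t ^+ 2) / (x + y)) +
       exp_coeff (t ^+ 2) n * (expR (t ^+ 2) / (x + y))))).
      apply: ler_wpM2l => //; apply: (le_trans (ler_normB _ _)); apply: lerD.
        apply: (le_trans (ler_norm_sum _ _ _)).
        exact: (bnd x y n (fun l => (n + l).+1)).
      apply: (le_trans (ler_norm_sum _ _ _)).
      under eq_bigr do rewrite [bessel_coef x _ * _]mulrC.
      exact: (bnd y x n (fun l => (l + n).+1)).
    rewrite /b le_eqVlt; apply/orP; left; apply/eqP; ring.
  have e : u = (u \- (fun n => (x ^+ 2 - y ^+ 2) * h n)) \+
    (fun n => (x ^+ 2 - y ^+ 2) * h n).
    by apply/funext => n /=; rewrite subrK.
  by rewrite e -[X in _ --> X]add0r; exact: cvgD.
exact: cvg_unique cd cu.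
Qed.

Lemma continuous_dsum p q x : 0 < x -> {for x, continuous (dsum p q x)}.
Proof.
move=> x0.
have ca k : bessel_coef y k @[y --> x] --> bessel_coef x k.
  apply: cvgM; first exact: cvg_cst.
  have p0 (y : R) : 0 < y -> k`!%:R * \prod_(m < k) (y + 1 + m%:R) != 0.
    move=> y0; rewrite mulf_neq0 ?pnatr_eq0 -?lt0n ?fact_gt0//.
    by rewrite gt_eqF// (lt_le_trans ltr01)// prod_shift_ge1.
  apply: cvgV; first exact: p0.
  apply: cvgM; first exact: cvg_cst.
  apply: cvg_big => [|m _]; first exact: mul_continuous.
  by apply: cvgD; [apply: cvgD; [exact: cvg_id|exact: cvg_cst]|exact: cvg_cst].
rewrite /dsum; apply: cvg_big => [|k _]; first exact: add_continuous.
apply: cvg_big => [|l _]; first exact: add_continuous.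
apply: cvgM; first by apply: cvgM; [exact: cvg_cst|exact: ca].
apply: cvgV; first by rewrite gt_eqF// ltr_wpDr ?mulr_ge0// addr_gt0.
by apply: cvgD; [apply: cvgD; [exact: cvg_cst|exact: cvg_id]|exact: cvg_cst].
Qed.

(** A uniform limit of continuous functions is continuous. *)
Lemma cvg_dlim_diag x : 0 < x -> dlim x y @[y --> x] --> dlim x x.
Proof.
move=> x0; apply/cvgrPdist_lt => e e0.
pose c := expR (t ^+ 2) / x.
have e3 : 0 < e / 3 by rewrite divr_gt0.
have := cvg_expR_tail2 c => /cvgrPdist_lt /(_ _ e3)[N _ /(_ N (leqnn N))] /= hN.
rewrite sub0r normrN in hN.
have bound y : 0 < y -> `|dlim x y - dsum N N x y| < e / 3.
  move=> y0; apply: (le_lt_trans (dsum_dlim N N x0 y0)).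
  apply: le_lt_trans hN; apply: le_trans (ler_norm _).
  rewrite /c; apply: ler_wpM2r; first by rewrite addr_ge0 ?expR_tail_ge0.
  rewrite ler_wpM2l ?expR_ge0//.
  by rewrite lef_pV2 ?posrE ?addr_gt0// lerDl ltW.
have := @continuous_dsum N N x x0 => /cvgrPdist_lt /(_ _ e3) cH.
near=> y.
have y0 : 0 < y by near: y; exact: lt_nbhsr.
have h1 := bound _ x0; have h2 := bound _ y0.
have h3 : `|dsum N N x x - dsum N N x y| < e / 3 by near: y.
rewrite (_ : _ - _ = (dlim x x - dsum N N x x) + (dsum N N x x - dsum N N x y) -
  (dlim x y - dsum N N x y)); last by ring.
apply: (le_lt_trans (ler_normB _ _)).
rewrite (_ : e = e / 3 + e / 3 + e / 3); last by field.
by rewrite ltrD// (le_lt_trans (ler_normD _ _))// ltrD.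
Unshelve. all: by end_near. Qed.

Lemma bessel_formula_dlim x y : 0 < x -> 0 < y -> x != y ->
  bessel_kernel_formula (t ^+ 2) x y = Num.sqrt (x * y) *
    (bessel_lead x * bessel_lead y) * dlim x y.
Proof.
move=> x0 y0 xy.
rewrite /bessel_kernel_formula sqrtr_sqr gtr0_norm//.
rewrite !besselJ_pred_series// !besselJ_series//.
have h := dlim_bessel x0 y0.
have d : x ^+ 2 - y ^+ 2 != 0.
  rewrite subr_sqr mulf_neq0// ?subr_eq0// gt_eqF// addr_gt0//.
have -> : dlim x y = (x ^+ 2 - y ^+ 2)^-1 * ((x ^+ 2 - y ^+ 2) * dlim x y).
  by rewrite mulrA mulVf// mul1r.
rewrite h; move: (limn _) (limn _) (limn _) (limn _) => a b c e; ring.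
Qed.

(** The L'Hospital limit: off the diagonal the formula is a product of
functions that are continuous at [n + 1]. *)
Lemma cvg_bessel_formula (n : nat) :
  bessel_kernel_formula (t ^+ 2) n.+1%:R y @[y --> (n.+1%:R : R)^'] -->
  Num.sqrt (n.+1%:R * n.+1%:R) * (bessel_lead n.+1%:R * bessel_lead n.+1%:R) *
    dlim n.+1%:R n.+1%:R.
Proof.
set x : R := n.+1%:R; have x0 : 0 < x by rewrite ltr0n.
have cG : Gamma (y + 1) @[y --> x] --> Gamma (x + 1).
  have -> : Gamma (x + 1) = n.+1`!%:R :> R by rewrite /x natr1 Gamma_nat.
  have := @Gamma_cvg_nat R n; rewrite -natr1 -/x => h.
  apply: (@cvg_comp _ _ _ (fun y => y + 1) (@Gamma R) _ _ _ _ h).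
  by apply: cvgD; [exact: cvg_id|exact: cvg_cst].
have G0 : Gamma (x + 1) != 0.
  by rewrite /x natr1 Gamma_nat pnatr_eq0 -lt0n fact_gt0.
have cp : t `^ y @[y --> x] --> t `^ x.
  rewrite (_ : powR t = (fun y => expR (y * ln t))); last first.
    by apply/funext => y; rewrite /powR gt_eqF.
  have h : continuous (fun y : R => expR (y * ln t)).
    move=> y; apply: continuous_comp; last exact: continuous_expR.
    by apply: cvgM; [exact: cvg_id|exact: cvg_cst].
  exact: h.
have cC : bessel_lead y @[y --> x] --> bessel_lead x.
  by apply: cvgM => //; exact: cvgV.
have cs : Num.sqrt (x * y) @[y --> x] --> Num.sqrt (x * x).
  have h : continuous (fun y : R => Num.sqrt (x * y)).
    move=> y; apply: continuous_comp; last exact: sqrt_continuous.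
    by apply: cvgM; [exact: cvg_cst|exact: cvg_id].
  exact: h.
have c : Num.sqrt (x * y) * (bessel_lead x * bessel_lead y) * dlim x y @[y --> x] -->
    Num.sqrt (x * x) * (bessel_lead x * bessel_lead x) * dlim x x.
  apply: cvgM; last exact: cvg_dlim_diag.
  by apply: cvgM => //; apply: cvgM => //; exact: cvg_cst.
have c' : Num.sqrt (x * y) * (bessel_lead x * bessel_lead y) * dlim x y @[y --> x^'] -->
    Num.sqrt (x * x) * (bessel_lead x * bessel_lead x) *
      dlim x x by exact: cvg_within_filter.
have n0 : \forall y \near x^', 0 < y by apply: nbhs_dnbhs; exact: lt_nbhsr.
have n1 : \forall y \near x^', y != x by exact: nbhs_dnbhs_neq.
apply: cvg_trans c'; apply: near_eq_cvg; near=> y.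
rewrite bessel_formula_dlim//.
  by near: y.
by rewrite eq_sym; near: y.
Unshelve. all: by end_near. Qed.

Lemma bessel_kernelE (i j : nat) :
  bessel_kernel (t ^+ 2) i.+1 j.+1 =
  Num.sqrt (i.+1%:R * j.+1%:R) * (bessel_lead i.+1%:R * bessel_lead j.+1%:R) *
    dlim i.+1%:R j.+1%:R.
Proof.
rewrite /bessel_kernel eqSS; case: eqVneq => [->|ij].
  by apply: cvg_lim => //; exact: cvg_bessel_formula.
by rewrite bessel_formula_dlim// eqr_nat eqSS.
Qed.

Lemma Kpoly_dsum (i j p q : nat) :
  (Kpoly i j p q).[t] =
  Num.sqrt (i.+1%:R * j.+1%:R) * (bessel_lead i.+1%:R * bessel_lead j.+1%:R) *
    dsum p q i.+1%:R j.+1%:R.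
Proof.
rewrite /Kpoly hornerZ sqrtrM// -mulrA; congr (_ * _).
rewrite /dsum horner_sum mulr_sumr; apply: eq_bigr => k _.
rewrite horner_sum mulr_sumr; apply: eq_bigr => l _.
rewrite hornerZ hornerXn /bessel_coef /bessel_lead !powR_mulrn ?(ltW t_gt0)// !natr1
  !Gamma_nat.
have fp (a b : nat) : (a + b)`!%:R = a`!%:R * \prod_(m < b) (a.+1%:R + m%:R) :> R.
  elim: b => [|b IH]; first by rewrite addn0 big_ord0 mulr1.
  rewrite addnS factS natrM IH big_ord_recr /= -natrD addSn; ring.
rewrite !fp.
have hs : t ^+ (i + k * 2 + (j + l * 2)).+2 =
    t ^+ i.+1 * t ^+ j.+1 * (t ^+ 2 ^+ k * t ^+ 2 ^+ l).
  by rewrite -!exprM -!exprD; congr (_ ^+ _); lia.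
have hd : (i + k * 2 + (j + l * 2)).+2%:R = i.+1%:R + j.+1%:R + 2 * (k + l)%:R :> R.
  by rewrite -natrM -!natrD; congr (_%:R); lia.
rewrite hs hd !invfM; ring.
Qed.

Lemma Kpoly_cvg (i j : nat) :
  (Kpoly i j (N - i) (N - j)).[t] @[N --> \oo] --> bessel_kernel (t ^+ 2) i.+1 j.+1.
Proof.
rewrite bessel_kernelE.
have -> : (fun N => (Kpoly i j (N - i) (N - j)).[t]) = (fun N =>
  Num.sqrt (i.+1%:R * j.+1%:R) * (bessel_lead i.+1%:R * bessel_lead j.+1%:R) *
   dsum (N - i) (N - j) i.+1%:R j.+1%:R).
  by apply/funext => N; rewrite Kpoly_dsum.
apply: cvgM; first exact: cvg_cst.
apply: (@cvg_dist_bound _ _ _ _ _ (fun N =>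
    expR (t ^+ 2) / (i.+1%:R + j.+1%:R) * (expR_tail (N - i) + expR_tail (N - j)))).
  by apply: nearW => N; rewrite distrC; apply: dsum_dlim.
have ce k : (fun N => expR_tail (N - k)%N) @ \oo --> (0 : R).
  by rewrite -(cvg_shiftn k); under eq_fun do rewrite addnK; exact: cvg_expR_tail.
set c := _ / _; have h : (fun N => c * (expR_tail (N - i) + expR_tail (N - j))) @ \oo
  --> c * (0 + 0).
  by apply: cvgM; [exact: cvg_cst|apply: cvgD; exact: ce].
by rewrite addr0 mulr0 in h.
Qed.

End bessel.

(** * The poissonized Plancherel measure as a limit of L-ensembles *)

Section partitions.

Lemma parts_sorted (la : strict_partition) : sorted gtn (parts la).
Proof. by case: la => s /= /andP[]. Qed.

Lemma parts_gt0 (la : strict_partition) k : k \in parts la -> (0 < k)%N.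
Proof. by case: la => s /= /andP[_ /negP s0]; case: k. Qed.

Lemma parts_uniq (la : strict_partition) : uniq (parts la).
Proof.
apply: sorted_uniq (parts_sorted la) => [a b c /= ba cb|a /=]; last by rewrite ltnn.
exact: ltn_trans cb ba.
Qed.

Lemma parts_inj (la mu : strict_partition) : parts la =i parts mu -> la = mu.
Proof.
move=> e; apply: val_inj; apply: irr_sorted_eq e; try exact: parts_sorted.
  by move=> a b c /= ba cb; exact: ltn_trans cb ba.
by move=> a /=; rewrite ltnn.
Qed.

Definition bounded_by (N : nat) : set strict_partition :=
  [set la | all (fun k => (k <= N)%N) (parts la)].

Definition part_set (N : nat) (la : strict_partition) : {set 'I_N} :=
  [set i : 'I_N | i.+1 \in parts la].

Lemma set_parts_proof N (S : {set 'I_N}) :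
  let s := rev [seq i.+1 | i <- [seq val i | i <- enum S]] in
  sorted gtn s && (0%N \notin s).
Proof.
apply/andP; split; last first.
  by rewrite mem_rev; apply/mapP => -[].
rewrite rev_sorted sorted_map.
apply: (@sub_sorted _ ltn) => [a b /=|]; first by rewrite ltnS.
rewrite sorted_map /enum_mem; apply: sorted_filter.
  by move=> a b c /=; exact: ltn_trans.
have : sorted ltn (map val (enum 'I_N)) by rewrite val_enum_ord iota_ltn_sorted.
by rewrite sorted_map enumT.
Qed.

Definition set_partition N (S : {set 'I_N}) : strict_partition :=
  StrictPartition (set_parts_proof S).

Lemma part_setK N (S : {set 'I_N}) : part_set N (set_partition S) = S.
Proof.
apply/setP => i; rewrite inE /= mem_rev mem_map; last exact: succn_inj.
by rewrite mem_map ?mem_enum//; exact: val_inj.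
Qed.

Lemma set_partition_bounded N (S : {set 'I_N}) : bounded_by N (set_partition S).
Proof.
rewrite /bounded_by /= all_rev; apply/allP => k /mapP[j /mapP[i _ ->] ->].
exact: ltn_ord.
Qed.

Lemma part_set_inj N la mu : bounded_by N la -> bounded_by N mu ->
  part_set N la = part_set N mu -> la = mu.
Proof.
move=> /allP laN /allP muN /setP e; apply: parts_inj => -[|k].
  by apply/idP/idP => /parts_gt0.
have [kN|Nk] := ltnP k N.
  by have := e (Ordinal kN); rewrite !inE.
by apply/idP/idP => [/laN|/muN]; rewrite leqNgt ltnS Nk.
Qed.

Lemma bounded_exists (la : strict_partition) : bounded_by (\sum_(k <- parts la) k)%N la.
Proof.
apply/allP => k kla; rewrite (big_rem k)//=; exact: leq_addr.
Qed.

Lemma size_weight (la : strict_partition) : (size la <= weight la)%N.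
Proof.
rewrite /weight sumnE; have : all (fun k => 0 < k)%N (parts la).
  by apply/allP => k /parts_gt0.
elim: (parts la) => [|a s IH] //= /andP[a0 /IH h].
by rewrite big_cons; lia.
Qed.

End partitions.

Section law.
Context {R : realType}.
Variable t : R.
Hypothesis t_gt0 : 0 < t.
Let theta : R := t ^+ 2.
Let theta_gt0 : 0 < theta. Proof. by rewrite exprn_gt0. Qed.

Definition pmass (la : strict_partition) : R :=
  poisson_pmf (theta / 2) (weight la) * plancherel_pmf (weight la) la.

Lemma pmass_ge0 la : 0 <= pmass la.
Proof. by rewrite mulr_ge0 ?poisson_pmf_ge0 ?plancherel_pmf_ge0. Qed.

(** The minor is given by Cauchy's formula in the parts; the powers of 2 match
because the length is at most the weight. *)
Lemma pmass_det N la : bounded_by N la ->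
  pmass la = expR (- (theta / 2)) * \det (pad_minor (part_set N la) (Lmx N t)).
Proof.
move=> /allP laN.
have mem_part (i : 'I_(size la)) : part la i \in parts la by rewrite mem_nth.
have part_gt0 (i : 'I_(size la)) : (0 < part la i)%N by exact: parts_gt0 (mem_part i).
have partN (i : 'I_(size la)) : ((part la i).-1 < N)%N.
  by rewrite prednK ?part_gt0// laN ?mem_part.
pose f i := Ordinal (partN i).
have fE i : (f i).+1 = part la i by rewrite /= prednK.
have f_inj : injective f.
  move=> i j /(congr1 (fun k : 'I_N => k.+1)); rewrite !fE => /eqP.
  by rewrite /part nth_uniq ?parts_uniq// => /eqP /val_inj.
have -> : part_set N la = [set f i | i : 'I_(size la)].
  apply/setP => k; rewrite inE; apply/idP/imsetP => [kla|[i _ ->]]; last first.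
    by rewrite fE mem_part.
  have h : (index k.+1 la < size la)%N by rewrite index_mem.
  exists (Ordinal h) => //; apply: val_inj => /=.
  by rewrite /part /= nth_index.
rewrite det_pad// det_mxsub_Lmx /pmass /poisson_pmf divr_gt0// /plancherel_pmf eqxx.
under [X in _ = _ * (_ * _ * X)]eq_bigr => i _.
  under eq_bigr => j _ do rewrite !fE; over.
under [X in _ = _ * (X * _ * _)]eq_bigr do rewrite fE.
under [X in _ = _ * (_ * X * _)]eq_bigr do rewrite fE.
set V := \prod_(i < size la) \prod_(j < size la | _) _.
have -> : \prod_(i < size la) t ^+ 2 ^+ part la i = theta ^+ weight la.
  by rewrite prodrXr /weight sumnE (big_nth 0%N) big_mkord.
set P := \prod_(i < size la) (part la i)`!%:R.
have -> : \prod_(i < size la) (2 * (part la i)`!%:R ^+ 2)^-1 = (2 ^+ size la * P ^+ 2)^-1.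
  by rewrite prodfV big_split /= prodr_const card_ord prodrXl.
have P0 : P != 0.
  by rewrite gt_eqF// prodr_gt0// => i _; rewrite ltr0n fact_gt0.
have w0 : (weight la)`!%:R != 0 :> R by rewrite pnatr_eq0 -lt0n fact_gt0.
have e2 : 2 ^+ weight la = 2 ^+ size la * 2 ^+ (weight la - size la) :> R.
  by rewrite -exprD subnKC// size_weight.
have p0 k : 2 ^+ k != 0 :> R by rewrite expf_neq0// pnatr_eq0.
rewrite expr_div_n e2; move: (p0 (size la)) (p0 (weight la - size la)%N) P0 w0.
move: (2 ^+ _) (2 ^+ _) P V (_`!%:R) (theta ^+ _) (expR _) => a b P V w c e a0 b0 P0 w0.
by field; rewrite a0 b0 P0 w0.
Qed.

Lemma esumZl (T : choiceType) (U : set T) (a : T -> \bar R) (c : R) : 0 < c ->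
  (forall i, 0 <= a i)%E ->
  (\esum_(i in U) (c%:E * a i) = c%:E * \esum_(i in U) a i)%E.
Proof.
move=> c0 a0; rewrite /esum -ereal_sup_pZl// image_comp; congr ereal_sup.
by apply: eq_imagel => A _ /=; rewrite ge0_mule_fsumr.
Qed.

(** Only the component of index [weight la] of the Poisson mixture charges [la];
the sum over [n] therefore runs over the partitions sorted by weight. *)
Lemma poissonized_plancherelE (U : set strict_partition) :
  poissonized_plancherel theta U = (\esum_(la in U) (pmass la)%:E)%E.
Proof.
pose F n := U `&` [set la | weight la = n].
have UE : U = \bigcup_n F n.
  by apply/seteqP; split => [la Ula|la [n _ []]//]; exists (weight la).
rewrite [in RHS]UE nneseries_sum_bigcup; last 2 first.
- by move=> m n _ _ [la [[_ /= <-] [_ /= <-]]].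
- by move=> la; rewrite lee_fin pmass_ge0.
rewrite /poissonized_plancherel /mseries /=; apply: eq_eseriesr => n _.
transitivity ((poisson_pmf (theta / 2) n)%:E *
  \esum_(la in U) (plancherel_pmf n la)%:E)%E.
  by [].
rewrite /F; have -> : (\esum_(la in U) (plancherel_pmf n la)%:E =
    \esum_(la in U `&` [set la | weight la = n]) (plancherel_pmf n la)%:E :> \bar R)%E.
  rewrite esum_mkcondr; apply: eq_esum => la _; case: ifPn => //.
  by rewrite notin_setE /= /plancherel_pmf => /eqP/negbTE ->.
rewrite -esumZl; last 2 first.
- by rewrite /poisson_pmf divr_gt0// mulr_gt0 ?expR_gt0// divr_gt0 ?exprn_gt0
    ?divr_gt0// ltr0n fact_gt0.
- by move=> la; rewrite lee_fin plancherel_pmf_ge0.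
by apply: eq_esum => la [_ /= <-].
Qed.

(** Partitions with parts at most [N] correspond to the subsets of ['I_N]. *)
Lemma esum_bounded N (n : nat) (f : 'I_n -> 'I_N) : injective f ->
  (\esum_(la in [set la | forall i, config la (f i).+1] `&` bounded_by N) (pmass la)%:E
  = (expR (- (theta / 2)) * (Zdet N t * \det (\matrix_(i, j) Kmx N t (f i) (f j))))%:E)%E.
Proof.
move=> f_inj; set U := [set la | _].
pose A : {set 'I_N} := [set f i | i : 'I_n].
pose a (S : {set 'I_N}) : \bar R := (expR (- (theta / 2)) *
  \det (pad_minor S (Lmx N t)))%:E.
transitivity (\esum_(S in [set S : {set 'I_N} | A \subset S]) a S)%E.
  rewrite (@reindex_esum _ _ _ (U `&` bounded_by N) _ (part_set N)).
    by apply: eq_esum => la [_ laN]; rewrite /a (pmass_det laN).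
  split.
  - move=> la [Ula _] /=; apply/fintype.subsetP => k /imsetP[i _ ->].
    by rewrite inE; exact: Ula.
  - move=> la mu; rewrite !inE => -[_ laN] [_ muN]; exact: part_set_inj.
  - move=> S /= AS; exists (set_partition S); last exact: part_setK.
    split; last exact: set_partition_bounded.
    move=> i; have : f i \in S by apply: (fintype.subsetP AS); apply/imsetP; exists i.
    by rewrite -{1}(part_setK S) inE.
rewrite esum_fset; last 2 first.
- exact: finite_finset.
- move=> S _; rewrite lee_fin mulr_ge0 ?expR_ge0//; exact: det_pad_Lmx_ge0.
transitivity (\sum_(S : {set 'I_N} | A \subset S) a S)%E.
  by rewrite [RHS]bigfs ?index_enum_uniq// => S _; rewrite mem_index_enum.
by rewrite -(correlation_Lmx t f_inj) mulr_sumr -sumEFin.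
Qed.

(** A finite set of partitions has bounded parts, so it is counted in [p N] for all
large [N]; conversely every [p N] is at most the full sum. *)
Lemma esum_bounded_limit (U : set strict_partition) (p : R^nat) (l : R) (m : nat -> nat) :
  (forall N, N <= m N)%N ->
  (forall N, \esum_(la in U `&` bounded_by (m N)) (pmass la)%:E = (p N)%:E)%E ->
  p @ \oo --> l -> (\esum_(la in U) (pmass la)%:E = l%:E)%E.
Proof.
move=> mN pE pl; apply/eqP; rewrite eq_le; apply/andP; split.
  apply: ge_ereal_sup => _ [X [finX XU]] <-.
  rewrite fsbig_finite//= sumEFin lee_fin.
  rewrite -(cvg_lim _ pl)//; apply: limr_ge; first by apply/cvg_ex; exists l.
  pose B := (\sum_(la <- fset_set X) \sum_(k <- parts la) k)%N.
  exists B => // N /= BN; rewrite -lee_fin -pE -sumEFin -fsbig_finite//=.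
  apply: esum_ge; exists X => //; split=> // la Xla; split; first exact: XU.
  have laX : la \in fset_set X by rewrite in_fset_set// inE.
  apply: sub_all (bounded_exists la) => k kla; apply: (leq_trans kla).
  apply: leq_trans (mN N); apply: leq_trans BN.
  by rewrite /B (big_rem la)//= leq_addr.
have le N : ((p N)%:E <= \esum_(la in U) (pmass la)%:E)%E.
  rewrite -pE esum_mkcondr; apply: le_esum => la _.
  by case: ifP => // _; rewrite lee_fin pmass_ge0.
have : (0 <= \esum_(la in U) (pmass la)%:E)%E.
  by apply: esum_ge0 => la _; rewrite lee_fin pmass_ge0.
case: (\esum_(la in U) _)%E le => [r le _|_ _|_] //=; last by rewrite leey.
rewrite lee_fin -(cvg_lim _ pl)//; apply: limr_le; first by apply/cvg_ex; exists l.
by apply: nearW => N; rewrite -lee_fin.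
Qed.
End law.

(** * Correlation functions *)

Section correlation.
Context {R : realType}.
Variable t : R.
Hypothesis t_gt0 : 0 < t.

(** The indices [a N] and [b N] are the same numbers [i] and [j], seen in ordinals
of growing size. *)
Lemma cvg_Kmx (i j B : nat) (a b : forall N, 'I_(N + B).+1) :
  (forall N, a N = i :> nat) -> (forall N, b N = j :> nat) ->
  (fun N => Kmx (N + B).+1 t (a N) (b N)) @ \oo --> bessel_kernel (t ^+ 2) i.+1 j.+1.
Proof.
move=> ai bj; pose q N := (Kpoly i j (N - i) (N - j)).[t].
pose e N := t * (trunc_err (1 + t) N *
   (Num.sqrt i.+1%:R * ((1 + t) ^+ i * expR ((1 + t) ^+ 2)) +
    Num.sqrt j.+1%:R * ((1 + t) ^+ j * expR ((1 + t) ^+ 2)) + trunc_err (1 + t) N)) * t.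
have ce : e @ \oo --> (0 : R).
  have h : e @ \oo --> t * (0 *
   (Num.sqrt i.+1%:R * ((1 + t) ^+ i * expR ((1 + t) ^+ 2)) +
    Num.sqrt j.+1%:R * ((1 + t) ^+ j * expR ((1 + t) ^+ 2)) + 0)) * t.
    apply: cvgM; last exact: cvg_cst.
    apply: cvgM; first exact: cvg_cst.
    apply: cvgM; first exact: cvg_trunc_err.
    by apply: cvgD; [exact: cvg_cst|exact: cvg_trunc_err].
  by rewrite mul0r mulr0 mul0r in h.
have cq : (fun N => q (N + B).+1) @ \oo --> bessel_kernel (t ^+ 2) i.+1 j.+1.
  by apply: cvg_shift_succ; exact: Kpoly_cvg.
have cd : ((fun N => Kmx (N + B).+1 t (a N) (b N)) \- (fun N => q (N + B).+1)) @ \oo -->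
  (0 : R).
  apply: (@cvg_dist_bound R _ _ _ _ (fun N => e (N + B).+1)); last exact: cvg_shift_succ.
  apply: nearW => N; rewrite subr0 /=.
  have := Kmx_Kpoly_bound (a N) (b N) t_gt0.
  by rewrite ai bj.
have -> : (fun N => Kmx (N + B).+1 t (a N) (b N)) =
  ((fun N => Kmx (N + B).+1 t (a N) (b N)) \- (fun N => q (N + B).+1)) \+
  (fun N => q (N + B).+1).
  by apply/funext => N /=; rewrite subrK.
by rewrite -[X in _ --> X]add0r; exact: cvgD.
Qed.

Lemma poissonized_correlation n (x : 'I_n -> nat) :
  (forall i, (0 < x i)%N) -> injective x ->
  poissonized_plancherel (t ^+ 2) [set w | forall i, config w (x i)] =
  (\det (\matrix_(i < n, j < n) bessel_kernel (t ^+ 2) (x i) (x j)))%:E.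
Proof.
move=> x0 x_inj; rewrite poissonized_plancherelE//.
(* A bound for all the points, so that they are available for every [N]. *)
pose B := (\sum_(i < n) x i)%N.
pose f N (i : 'I_n) : 'I_(N + B).+1 := inord (x i).-1.
have fE N i : f N i = (x i).-1 :> nat.
  rewrite inordK// ltnS; apply: leq_trans (leq_pred _) _.
  by rewrite /B (bigD1 i)//= addnCA leq_addr.
have fS N i : (f N i).+1 = x i by rewrite fE prednK.
have f_inj N : injective (f N).
  by move=> i j /(congr1 (fun k : 'I_(N + B).+1 => k.+1)); rewrite !fS => /x_inj.
pose a : R := t ^+ 2 / 2.
pose p N := expR (- a) *
  (Zdet (N + B).+1 t * \det (\matrix_(i, j) Kmx (N + B).+1 t (f N i) (f N j))).
apply: (@esum_bounded_limit _ t _ p _ (fun N => (N + B).+1)).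
- by move=> N; rewrite leqW// leq_addr.
- move=> N; rewrite -(esum_bounded t_gt0 (f_inj N)); congr esum.
  congr (_ `&` _); apply/seteqP; split => w /= h i; first by rewrite fS.
  by rewrite -(fS N).
- have h : p @ \oo --> expR (- a) * (expR a *
      \det (\matrix_(i < n, j < n) bessel_kernel (t ^+ 2) (x i) (x j))).
    apply: cvgM; first exact: cvg_cst.
    apply: cvgM; first by apply: (@cvg_shift_succ R B (fun N => Zdet N t));
      exact: cvg_Zdet.
    apply: cvg_det => i j; rewrite mxE.
    under eq_fun do rewrite mxE.
    rewrite -(prednK (x0 i)) -(prednK (x0 j)).
    by apply: cvg_Kmx => N; exact: fE.
  by rewrite mulrA -expRD addNr expR0 mul1r in h.
Qed.

End correlation.

(* The first clause says that the L'Hospital limits in [bessel_kernel] exist. *)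
Theorem theorem2p3 (R : realType) (theta : R) (theta_gt0 : 0 < theta) :
  (forall x : nat, (0 < x)%N ->
     cvg (bessel_kernel_formula theta x%:R y @[y --> (x%:R : R)^'])) /\
  determinantal (poissonized_plancherel theta) config (bessel_kernel theta).
Proof.
have t_gt0 : 0 < Num.sqrt theta by rewrite sqrtr_gt0.
rewrite -(sqr_sqrtr (ltW theta_gt0)); split.
  by move=> [//|n] _; exact: cvgP (@cvg_bessel_formula _ _ t_gt0 n).
split=> [x _|n x x0 x_inj]; first by [].
exact: (poissonized_correlation t_gt0 x0 x_inj).
Qed.
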